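(* Let $n\ge1$, $s\in(0,1)$. There exists $c\in(0,1)$, depending only on $n$ and $s$, such that for all disjoint measurable sets $A,B\subset\mathbb{R}^n$, with $D:=\mathbb{R}^n\setminus(A\cup B)$: <ul> <li>if $|B|\le c|A|$ and $|A|>0$, then $$L(A,D)\ge\begin{cases}c\,|A|^{(n-2s)/n} & \text{if } s\in(0,1/2),\\ c\,|A|^{(n-1)/n}\log(|A|/|B|) & \text{if } s=1/2,\\ c\,|A|^{(n-2s)/n}\big(|B|/|A|\big)^{1-2s} & \text{if } s\in(1/2,1);\end{cases}$$</li> <li>if $|B|>c|A|$, then $L(A,D)\ge c\,|A|^{(n-2s)/n}\big(|B|/|A|\big)^{-2s/n}$.</li> </ul>
   Context: For measurable $A,D\subset\mathbb{R}^n$, $L(A,D):=\int_A\int_D\frac{dx\,dy}{|x-y|^{n+2s}}$. $|\cdot|$ denotes Lebesgue measure.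
   Formalization: Proved for Borel sets A, B with |A|, |B| finite: |A|<∞ is needed (A=R^n, B=∅, s<1/2 gives L=0 against c·∞); if |B|=∞ the bound is the trivial L≥0; Lebesgue measurable sets differ from Borel ones by null sets; for |B|=0, s≥1/2 the bound reads L=+∞. *)

(* Defs.v *)
From HB Require Import structures.
From mathcomp Require Import all_boot all_order all_algebra.
From mathcomp Require Import all_classical all_reals all_analysis.
Set Implicit Arguments. Unset Strict Implicit. Unset Printing Implicit Defensive.
Import Order.TTheory GRing.Theory Num.Theory.
Import numFieldNormedType.Exports.
Local Open Scope classical_set_scope.
Local Open Scope ring_scope.

(* Product of two sigma-finite measures (an alias of the library's
   [product_measure1], i.e. [m1 \x m2], re-declared so that its canonical
   sigma-finite-measure structure is found by inference; the library's
   canonical SigmaFiniteMeasure instance on [product_measure1] is the one for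
   subprobabilities only). *)
Section prodm.
Local Open Scope ereal_scope.
Context d1 d2 (T1 : measurableType d1) (T2 : measurableType d2) (R : realType).
Variable m1 : {sigma_finite_measure set T1 -> \bar R}.
Variable m2 : {sigma_finite_measure set T2 -> \bar R}.
Definition prodm := product_measure1 m1 m2.
HB.instance Definition _ := Measure.on prodm.
Lemma prodm_sigma_finite : sigma_finite setT prodm.
Proof.
have /sigma_finiteP[F [TF ndF Foo]] := sigma_finiteT m1.
have /sigma_finiteP[G [TG ndG Goo]] := sigma_finiteT m2.
exists (fun n => F n `*` G n).
 rewrite -setXTT TF TG predeqE => -[x y]; split.
    move=> [/= [n _ Fnx] [k _ Gky]]; exists (maxn n k) => //; split.
    - by move: x Fnx; exact/subsetPset/ndF/leq_maxl.
    - by move: y Gky; exact/subsetPset/ndG/leq_maxr.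
  by move=> [n _ []/= ? ?]; split; exists n.
move=> k; have [? ?] := Foo k; have [? ?] := Goo k.
split; first exact: measurableX.
by rewrite /prodm product_measure1E// lte_mul_pinfty// ge0_fin_numE.
Qed.
HB.instance Definition _ :=
  Measure_isSigmaFinite.Build _ _ _ prodm prodm_sigma_finite.
End prodm.

Record mspace (R : realType) := MSpace {
  ms_disp : measure_display;
  ms_car : measurableType ms_disp;
  ms_mu : {sigma_finite_measure set ms_car -> \bar R} }.

(* [euclid R n] is Euclidean space R^(n+1), built as the iterated product
   (...((R * R) * R) ...) * R with n+1 factors, carrying the product of the
   Borel sigma-algebras (= Borel sigma-algebra of R^(n+1)) and the
   (n+1)-dimensional Lebesgue measure, obtained as iterated product of the
   1-dimensional Lebesgue measure [lebesgue_measure]. *)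
Fixpoint euclid (R : realType) (n : nat) : mspace R :=
  match n with
  | 0 => @MSpace R _ (measurableTypeR R) (@lebesgue_measure R)
  | m.+1 => let M := euclid R m in
      @MSpace R _ (ms_car M * measurableTypeR R)%type
        (@prodm _ _ _ _ R (ms_mu M) (@lebesgue_measure R))
  end.

Definition Rn (R : realType) (n : nat) : measurableType _ := ms_car (euclid R n).
Definition leb (R : realType) (n : nat) := ms_mu (euclid R n).

Fixpoint dist2 (R : realType) (n : nat) : Rn R n -> Rn R n -> R :=
  match n return Rn R n -> Rn R n -> R with
  | 0 => fun x y => ((x : R) - (y : R)) ^+ 2
  | m.+1 => fun x y => dist2 x.1 y.1 + ((x.2 : R) - (y.2 : R)) ^+ 2
  end.

Definition edist (R : realType) (n : nat) (x y : Rn R n) : R :=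
  Num.sqrt (dist2 x y).

(* L(A,D) = int_A int_D |x-y|^{-(N+2s)} dy dx in dimension N = n+1.
   The kernel is extended by +oo on the diagonal x = y (its natural value
   as an extended nonnegative function; the diagonal is a null set). *)
Definition Lint (R : realType) (n : nat) (s : R) (A D : set (Rn R n)) : \bar R :=
  (\int[leb R n]_(x in A) \int[leb R n]_(y in D)
     (if (edist x y == 0)%R then +oo
      else ((edist x y) `^ (- ((n.+1)%:R + 2 * s))%R)%:E))%E.

(* Main.v *)
Require Import Defs.
From HB Require Import structures.
From mathcomp Require Import all_boot all_order all_algebra.
From mathcomp Require Import all_classical all_reals all_analysis.
From mathcomp Require Import measurable_realfun.
From mathcomp Require Import ring lra.
Import Order.TTheory GRing.Theory Num.Theory.
Import numFieldNormedType.Exports.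
Local Open Scope classical_set_scope.
Local Open Scope ring_scope.

(** Write [L(A,D)] as the integral over the displacement [h] of
    [|A n (D - h)| / |h|^(N+2s)]. The function [f(h) = |A \ (A - h)|]
    is subadditive and its average over a cube shell of volume about [|A|] is of
    order [|A|]; halving [h] at most halves [f(h)], so on the [j]-th dyadic
    subshell the average of [f] is at least of order [2^-j |A|]. Since
    [|A n (D - h)| >= f(h) - |B|], every dyadic scale [2^-j >= 4|B|/|A|]
    contributes at least a constant times [|A|^(1-2s/N) 2^(j(2s-1))]: the
    first scale, their number, and the last scale give the three regimes for
    small [|B|]. For large [|B|] it is enough that [D] fills half of a cube of
    volume [2(|A| + |B|)] centred at any point of [A].

    The same [c] is both the threshold for [|B|/|A|] and the constant of the
    estimates. When [2s >= N], that is for [N = 1] and [s >= 1/2], letting [c]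
    be small is therefore not sufficient just above the threshold, where
    [L(A,D) >= |B|^(1-2s)] is needed with constant 1. In dimension one, if
    [m] is the mass of [A] to the right of [x], rearranging the part of [D] to
    the right of [x] gives at least [(m + |B|)^(-2s) / (2s)]. As [m] is
    uniformly distributed on [(0,|A|)] when [x] runs through [A], the two sides
    together give [|B|^(1-2s) / (s(2s-1))] up to a vanishing error, and
    [s(2s-1) < 1]. *)

(** * Inequalities for negative powers *)

Section powR_facts.
Context {R : realType}.

Lemma powRN_le (e u v : R) : 0 <= e -> 0 < u -> u <= v ->
  v `^ (- e) <= u `^ (- e).
Proof.
move=> e0 u0 uv; have v0 := lt_le_trans u0 uv.
rewrite !powRN lef_pV2 ?posrE ?powR_gt0//.
by apply: ge0_ler_powR; rewrite ?nnegrE// ltW.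
Qed.

Lemma powRDg (x u v : R) : 0 < x -> x `^ (u + v) = x `^ u * x `^ v.
Proof. by move=> x0; rewrite powRD// lt0r_neq0 ?implybT. Qed.

(** After division by [u ^ (- t)] this is the Bernoulli inequality [(1 + x) ^ (- t) >= 1 - t x],
    which follows from [exp y >= 1 + y] and [ln (1 + x) <= x]. It serves to compare a sum of powers
    with a telescoping one. *)
Lemma powRN_sub_le (t u d : R) : 0 < t -> 0 < u -> 0 <= d ->
  u `^ (- t) - (u + d) `^ (- t) <= t * d * u `^ (- (1 + t)).
Proof.
move=> t0 u0 d0; have du0 : 0 <= d / u by rewrite divr_ge0// ltW.
have -> : u + d = u * (1 + d / u) by field; exact: lt0r_neq0.
rewrite powRM; [|exact: ltW|lra].
rewrite opprD powRDg// powR_inv1; last by rewrite ltW.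
have H : 1 - t * (d / u) <= (1 + d / u) `^ (- t).
  rewrite /powR gt_eqF; last by lra.
  apply: le_trans (expR_ge1Dx _).
  rewrite mulNr lerD2l lerN2; apply: (ler_wpM2l (ltW t0)).
  apply: le_ln1Dx; lra.
have := ler_wpM2l (powR_ge0 u (- t)) H.
have -> : t * d * (u^-1 * u `^ (- t)) = u `^ (- t) * (t * (d / u)) by ring.
lra.
Qed.

End powR_facts.

(** * Measures and integrals *)

Lemma measurable_preimageT {d d' : measure_display} {U : measurableType d}
    {V : measurableType d'} {f : U -> V} {Y : set V} :
  measurable_fun setT f -> measurable Y -> measurable (f @^-1` Y).
Proof. by move=> mf mY; rewrite -[X in measurable X]setTI; exact: mf. Qed.

Section pushforward_prod.
Local Open Scope ereal_scope.
Context {d1 d2 : measure_display} {T1 : measurableType d1}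
  {T2 : measurableType d2} {R : realType}.
Variables (m1 : {sigma_finite_measure set T1 -> \bar R})
  (m2 : {sigma_finite_measure set T2 -> \bar R}).

(** By uniqueness of the product measure, it is enough to compare both sides on rectangles. This
    gives the induction step for translations and dilations, and a dilation of the displacement
    alone. *)
Lemma prodm_scaled_preimage (f1 : T1 -> T1) (f2 : T2 -> T2) (c1 c2 : R) :
  (0 <= c1)%R -> (0 <= c2)%R ->
  measurable_fun setT f1 -> measurable_fun setT f2 ->
  (forall A, measurable A -> m1 A = c1%:E * m1 (f1 @^-1` A)) ->
  (forall A, measurable A -> m2 A = c2%:E * m2 (f2 @^-1` A)) ->
  forall A, measurable A ->
  prodm m1 m2 A = (c1 * c2)%:E * prodm m1 m2 ((fun z => (f1 z.1, f2 z.2)) @^-1` A).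
Proof.
move=> c10 c20 mf1 mf2 H1 H2 A mA.
have mf : measurable_fun [set: (T1 * T2)%type] (fun z => (f1 z.1, f2 z.2)).
  by apply: measurable_fun_pair => /=; apply: measurableT_comp.
have c0 : (0 <= c1 * c2)%R by rewrite mulr_ge0.
have Hp := @product_measure_unique _ _ _ _ _ m1 m2
  (mscale (NngNum c0) (pushforward (prodm m1 m2) (fun z => (f1 z.1, f2 z.2)))).
rewrite [LHS]Hp //.
move=> A1 A2 mA1 mA2.
rewrite -[LHS]/((c1 * c2)%:E *
  product_measure1 m1 m2 ((f1 @^-1` A1) `*` (f2 @^-1` A2))).
rewrite product_measure1E.
- by rewrite (H1 _ mA1) (H2 _ mA2) EFinM muleACA.
- by rewrite -[X in measurable X]setTI; exact: mf1.
- by rewrite -[X in measurable X]setTI; exact: mf2.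
Qed.

(** Tonelli for an indicator: both iterated integrals are measures that agree on rectangles. The
    left side is [prodm] by definition; the right side gives access to slices at a fixed second
    coordinate. *)
Lemma integral_xsection_ysection (A : set (T1 * T2)) : measurable A ->
  \int[m1]_x m2 (xsection A x) = \int[m2]_y m1 (ysection A y).
Proof.
move=> mA.
have -> : \int[m1]_x m2 (xsection A x) = product_measure1 m1 m2 A by [].
have -> : \int[m2]_y m1 (ysection A y) = product_measure2 m1 m2 A by [].
by apply: product_measure_unique => //= ? ? ? ?; rewrite product_measure2E.
Qed.

End pushforward_prod.

Section integral_lower_bounds.
Local Open Scope ereal_scope.
Context {d : measure_display} {T : measurableType d} {R : realType}.
Variable mu : {measure set T -> \bar R}.

Lemma ge0_integral_ge_sum (D : set T) (f : T -> \bar R) (J : nat)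
    (F : nat -> set T) (v : nat -> R) :
  measurable D -> measurable_fun setT f -> (forall x, 0 <= f x) ->
  (forall i, measurable (F i)) -> trivIset setT F ->
  (forall i, (i < J)%N -> F i `<=` D) -> (forall i, (0 <= v i)%R) ->
  (forall i, (i < J)%N -> forall x, F i x -> (v i)%:E <= f x) ->
  \sum_(0 <= i < J) (v i)%:E * mu (F i) <= \int[mu]_(x in D) f x.
Proof.
move=> mD mf f0 mF tF FD v0 vf.
have mfE E : measurable_fun E f by exact: measurable_funTS.
apply: (@le_trans _ _ (\int[mu]_(y in \big[setU/set0]_(i <- index_iota 0 J) F i) f y)).
  rewrite ge0_integral_bigsetU//; last 2 first.
  - exact: iota_uniq.
  - exact: sub_trivIset tF.
  rewrite big_nat_cond [leRHS]big_nat_cond.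
  apply: lee_sum => i /andP[/andP[_ iJ] _]; rewrite -integral_cst//.
  apply: ge0_le_integral => //.
  - by move=> y _; rewrite lee_fin.
  - exact: vf.
apply: ge0_subset_integral => //.
- exact: bigsetU_measurable.
- by rewrite -bigcup_seq => y [i /=]; rewrite mem_index_iota => /andP[_ iJ] /(FD _ iJ).
Qed.

(** The part of [U] missing from [D] is exchanged for the part of [J] inside [D]: its measure is at
    least as large, and [f] is at least [v] there but at most [v] on [U]. *)
Lemma bathtub_integral_le (D J U : set T) (f : T -> \bar R) (v : R) :
  measurable D -> measurable J -> measurable U -> J `&` U = set0 ->
  measurable_fun setT f -> (forall x, 0 <= f x) -> (0 <= v)%R ->
  (forall x, J x -> v%:E <= f x) -> (forall x, U x -> f x <= v%:E) ->
  mu (U `\` D) <= mu (J `&` D) ->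
  \int[mu]_(x in U) f x <= \int[mu]_(x in D `&` (J `|` U)) f x.
Proof.
move=> mD mJ mU JU mf f0 v0 vJ vU UD.
have mfE E : measurable_fun E f by exact: measurable_funTS.
have mUD : measurable (U `&` D) by exact: measurableI.
have mUD' : measurable (U `\` D) by exact: measurableD.
have mJD : measurable (J `&` D) by exact: measurableI.
rewrite -[in leLHS](setUIDK U D) ge0_integral_setU//; last first.
  by apply/disj_setPS => x [[_ Dx] [_ /(_ Dx)]].
have -> : D `&` (J `|` U) = (U `&` D) `|` (J `&` D).
  by rewrite setIUr setUC setIC [D `&` J]setIC.
rewrite ge0_integral_setU//; last first.
  apply/disj_setPS => x [[Ux _] [Jx _]].
  by have : (J `&` U) x by []; rewrite JU.
apply: leeD => //; apply: (@le_trans _ _ (v%:E * mu (U `\` D))).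
  rewrite -integral_cst//; apply: ge0_le_integral => //.
  by move=> x [Ux _]; exact: vU.
apply: (@le_trans _ _ (v%:E * mu (J `&` D))); first by rewrite lee_wpmul2l// lee_fin.
rewrite -integral_cst//; apply: ge0_le_integral => //.
by move=> x [Jx _]; exact: vJ.
Qed.

End integral_lower_bounds.

(** * Euclidean space as an iterated product *)

Section rn.
Context {R : realType}.

Fixpoint vadd (n : nat) : Rn R n -> Rn R n -> Rn R n :=
  match n return Rn R n -> Rn R n -> Rn R n with
  | 0 => fun x y => (x : R) + (y : R)
  | m.+1 => fun x y => (vadd m x.1 y.1, (x.2 : R) + (y.2 : R))
  end.

Fixpoint vscale (n : nat) (k : R) : Rn R n -> Rn R n :=
  match n return Rn R n -> Rn R n with
  | 0 => fun x => k * (x : R)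
  | m.+1 => fun x => (vscale m k x.1, k * (x.2 : R))
  end.

(** Cubes replace balls because their measure and their preimages under dilations are computed
    coordinate by coordinate. *)
Fixpoint cube (n : nat) (r : R) : set (Rn R n) :=
  match n return set (Rn R n) with
  | 0 => `[- r, r]%classic : set R
  | m.+1 => cube m r `*` (`[- r, r]%classic : set R)
  end.

Lemma measurable_vadd n :
  measurable_fun setT (fun z : Rn R n * Rn R n => vadd n z.1 z.2).
Proof.
elim: n => [|n IH] /=.
  by apply: measurable_funD; [exact: measurable_fst|exact: measurable_snd].
apply: measurable_fun_pair => /=.
  apply: (measurableT_comp IH (g := fun z : Rn R n.+1 * Rn R n.+1 => (z.1.1, z.2.1))).
  apply: measurable_fun_pair => /=.
    apply: (measurableT_comp measurable_fst) => //; exact: measurable_fst.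
  apply: (measurableT_comp measurable_fst) => //; exact: measurable_snd.
apply: measurable_funD => /=.
  apply: (measurableT_comp measurable_snd) => //; exact: measurable_fst.
apply: (measurableT_comp measurable_snd) => //; exact: measurable_snd.
Qed.

Lemma measurable_vaddl n (h : Rn R n) : measurable_fun setT (vadd n h).
Proof.
have -> : vadd n h = (fun z => vadd n z.1 z.2) \o pair h by [].
apply: (measurableT_comp (measurable_vadd n)); exact: pair1_measurable.
Qed.

Lemma measurable_vscale n (k : R) : measurable_fun setT (vscale n k).
Proof.
elim: n => [|n IH] /=; first exact: mulrl_measurable.
apply: measurable_fun_pair => /=.
  by apply: (measurableT_comp IH); exact: measurable_fst.
by apply: measurable_funM => //; exact: measurable_snd.
Qed.

Lemma vaddK n (x : Rn R n) : cancel (vadd n x) (vadd n (vscale n (-1) x)).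
Proof.
elim: n x => [|n IH] x y /=; first by rewrite mulN1r addKr.
by rewrite IH mulN1r addKr; case: y.
Qed.

Lemma vaddA n : associative (vadd n).
Proof. by elim: n => [|n IH] x y z /=; rewrite ?IH addrA. Qed.

Lemma vaddC n : commutative (vadd n).
Proof. by elim: n => [|n IH] x y /=; rewrite ?(IH x.1) addrC. Qed.

Lemma vscale_half n (h : Rn R n) : vadd n (vscale n 2^-1 h) (vscale n 2^-1 h) = h.
Proof.
elim: n h => [|n IH] h /=; first by field.
by case: h => h1 h2 /=; rewrite IH; congr pair; field.
Qed.

(** Both sides are measures in [A], so by uniqueness of Lebesgue measure it suffices to check
    half-open intervals. *)
Lemma lebesgue_measure_affine (k h : R) (A : set (measurableTypeR R)) :
  0 < k -> measurable A ->
  lebesgue_measure A = (k%:E * lebesgue_measure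
    ((fun x : measurableTypeR R => (h + k * x)%R : measurableTypeR R) @^-1` A))%E.
Proof.
move=> k0 mA; pose f := fun x : measurableTypeR R => (h + k * x : measurableTypeR R).
have mf : measurable_fun setT f.
  by apply: measurable_funD => //; exact: mulrl_measurable.
have Hu := @lebesgue_measure_unique R
  (mscale (NngNum (ltW k0)) (pushforward lebesgue_measure f)).
rewrite [LHS]Hu// => _ [[a b]] _ <-.
rewrite -[RHS]/(k%:E * lebesgue_measure (f @^-1` `]a, b]))%E.
have -> : f @^-1` `]a, b] = `](a - h) / k, (b - h) / k]%classic.
  apply/seteqP; split => x /=; rewrite !in_itv/= ltr_pdivrMr// ler_pdivlMr// /f.
    by move=> /andP[? ?]; apply/andP; split; lra.
  by move=> /andP[? ?]; apply/andP; split; lra.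
rewrite !lebesgue_measure_itv/= !lte_fin ltr_pM2r ?invr_gt0// ltrD2r.
case: ifPn => _; last by rewrite mule0.
by rewrite -!EFinB -EFinM; congr EFin; field; exact: lt0r_neq0.
Qed.

Lemma leb_vadd n (h : Rn R n) (A : set (Rn R n)) : measurable A ->
  leb R n (vadd n h @^-1` A) = leb R n A.
Proof.
elim: n h A => [|n IH] h A mA.
  have := @lebesgue_measure_affine 1 h A ltr01 mA; rewrite mul1e => E.
  rewrite -[RHS]/(lebesgue_measure (A : set (measurableTypeR R))) E.
  by congr (lebesgue_measure _); apply: eq_set => x /=; rewrite mul1r.
have := @prodm_scaled_preimage _ _ _ _ _ (leb R n) lebesgue_measure (vadd n h.1)
  (fun x : measurableTypeR R => ((h.2 : R) + x : measurableTypeR R)) 1 1 ler01 ler01.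
move/(_ (measurable_vaddl _ _)).
have mf : measurable_fun setT
    (fun x : measurableTypeR R => ((h.2 : R) + x : measurableTypeR R)).
  exact: measurable_funD.
move=> /(_ mf) H; apply/esym; rewrite [LHS](H _ _ _ mA) ?mulr1 ?mul1e//.
  by move=> B mB; rewrite mul1e IH.
move=> B mB; rewrite [LHS](@lebesgue_measure_affine 1 h.2 B ltr01 mB).
by congr (_ * lebesgue_measure _)%E; apply: eq_set => x /=; rewrite mul1r.
Qed.

Lemma leb_vscale n (k : R) (A : set (Rn R n)) : 0 < k -> measurable A ->
  (leb R n A = (k ^+ n.+1)%:E * leb R n (vscale n k @^-1` A))%E.
Proof.
move=> k0; elim: n A => [|n IH] A mA.
  rewrite expr1 -[LHS]/(lebesgue_measure (A : set (measurableTypeR R))).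
  rewrite (@lebesgue_measure_affine k 0 A k0 mA).
  by congr (_ * lebesgue_measure _)%E; apply: eq_set => x /=; rewrite add0r.
rewrite exprSr.
apply: (@prodm_scaled_preimage _ _ _ _ _ (leb R n) lebesgue_measure (vscale n k)
  (fun x : measurableTypeR R => (k * x : measurableTypeR R))) => //.
- by rewrite exprn_ge0// ltW.
- exact: ltW.
- exact: measurable_vscale.
- exact: mulrl_measurable.
move=> B mB; rewrite [LHS](@lebesgue_measure_affine k 0 B k0 mB).
by congr (_ * lebesgue_measure _)%E; apply: eq_set => x /=; rewrite add0r.
Qed.

Lemma measurable_cube n (r : R) : measurable (cube n r).
Proof. by elim: n => [|n IH] /=; [|apply: measurableX => //]; exact: measurable_itv. Qed.

Lemma leb_cube n (r : R) : 0 <= r -> leb R n (cube n r) = ((2 * r) ^+ n.+1)%:E.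
Proof.
move=> r0; have H : lebesgue_measure (`[- r, r]%classic : set R) = (2 * r)%:E.
  rewrite lebesgue_measure_itv/= lte_fin.
  case: ltP => rr; first by rewrite -EFinB; congr EFin; ring.
  have -> : r = 0 by apply: le_anti; rewrite r0 andbT; lra.
  by rewrite mulr0.
elim: n => [|n IH]; first by rewrite expr1 -H.
rewrite /leb/= /prodm product_measure1E.
- by rewrite [X in (X * _)%E]IH [X in (_ * X)%E]H -EFinM -exprSr.
- exact: measurable_cube.
- exact: measurable_itv.
Qed.

Lemma subset_cube n (r r' : R) : r <= r' -> cube n r `<=` cube n r'.
Proof.
move=> rr; elim: n => [|n IH] x /=; rewrite !in_itv/=.
  by move=> /andP[? ?]; apply/andP; split; lra.
by move=> [/IH ? /andP[? ?]]; split => //; rewrite ?in_itv/=; apply/andP; split; lra.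
Qed.

Lemma preimage_vscale_cube n (k r : R) : 0 < k ->
  vscale n k @^-1` cube n r = cube n (r / k).
Proof.
move=> k0; have H (x : R) : (- r <= k * x <= r) = (- (r / k) <= x <= r / k).
  by rewrite -mulNr ler_pdivrMr// ler_pdivlMr// mulrC.
elim: n => [|n IH]; first by apply/seteqP; split => x /=; rewrite !in_itv/= H.
have {}H : ( *%R k : measurableTypeR R -> measurableTypeR R) @^-1` `[- r, r] =
    `[- (r / k), r / k]%classic.
  by apply/seteqP; split => x /=; rewrite !in_itv/= H.
by rewrite [RHS]/= -IH -H.
Qed.

Lemma dist2_vadd_cube n (x h : Rn R n) (r : R) : cube n r h ->
  dist2 x (vadd n x h) <= n.+1%:R * r ^+ 2.
Proof.
have H (u v : R) : - r <= v <= r -> (u - (u + v)) ^+ 2 <= r ^+ 2.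
  by move=> /andP[? ?]; nra.
elim: n x h => [|n IH] x h /=; rewrite ?in_itv/=; first by rewrite mul1r; exact: H.
case=> /(IH x.1) h1; rewrite ?in_itv/= => /(H x.2) h2.
by rewrite -[n.+2]addn1 natrD mulrDl mul1r lerD.
Qed.

Lemma edist_vadd_cube n (x h : Rn R n) (r : R) : 0 <= r -> cube n r h ->
  Defs.edist x (vadd n x h) <= n.+1%:R * r.
Proof.
move=> r0 /(dist2_vadd_cube n x) H.
have nr0 : 0 <= n.+1%:R * r :> R by rewrite mulr_ge0.
rewrite -(ger0_norm nr0) -sqrtr_sqr; apply: ler_wsqrtr.
(* The factor [sqrt (n + 1)] is enlarged to [n + 1]; only the constants suffer. *)
apply: (le_trans H); rewrite exprMn ler_wpM2r ?sqr_ge0//.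
by rewrite expr2 ler_peMr// ler1n.
Qed.

Lemma measurable_edist n :
  measurable_fun setT (fun z : Rn R n * Rn R n => Defs.edist z.1 z.2).
Proof.
have md : measurable_fun setT (fun z : Rn R n * Rn R n => dist2 z.1 z.2).
  elim: n => [|n IH] /=.
    apply: measurable_funX.
    by apply: measurable_funB; [exact: measurable_fst|exact: measurable_snd].
  apply: measurable_funD => /=.
    apply: (measurableT_comp IH (g := fun z : Rn R n.+1 * Rn R n.+1 => (z.1.1, z.2.1))).
    apply: measurable_fun_pair => /=.
      apply: (measurableT_comp measurable_fst) => //; exact: measurable_fst.
    apply: (measurableT_comp measurable_fst) => //; exact: measurable_snd.
  apply: measurable_funX; apply: measurable_funB.
    apply: (measurableT_comp measurable_snd) => //; exact: measurable_fst.
  apply: (measurableT_comp measurable_snd) => //; exact: measurable_snd.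
apply: (measurableT_comp _ md); apply: continuous_measurable_fun.
exact: sqrt_continuous.
Qed.

End rn.

(** * Pairs of points with prescribed displacement *)

Section correlation.
Local Open Scope ereal_scope.
Context {R : realType} (n : nat).
Notation T := (Rn R n).
Notation mu := (leb R n).
Notation M := (prodm (leb R n) (leb R n)).
Implicit Types A B E S : set T.

(** Pairs of a point [x] and a displacement [h]: by Tonelli the measure of this set is the integral
    over [h] in [S] of [|A n (E - h)|]. With [E] the complement of [A], it is the integral of the
    function [f] of the overview. *)
Definition corr A E S : set (T * T) :=
  [set z | [/\ A z.1, S z.2 & E (vadd n z.1 z.2)]].

Lemma measurable_corr A E S : measurable A -> measurable E -> measurable S ->
  measurable (corr A E S).
Proof.
move=> mA mE mS.
have -> : corr A E S = (A `*` S) `&`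
    ((fun z : T * T => vadd n z.1 z.2) @^-1` E).
  by apply/seteqP; split => [z [? ? ?]|z [[? ?] ?]].
apply: measurableI; first exact: measurableX.
exact: (measurable_preimageT (measurable_vadd n)).
Qed.

(** At each fixed displacement the shear is a translation of the slice, which preserves its
    measure. *)
Lemma prodm_shear1 (g : T -> T) (W : set (T * T)) : measurable_fun setT g ->
  measurable W ->
  M ((fun z => (vadd n z.1 (g z.2), z.2)) @^-1` W) = M W.
Proof.
move=> mg mW; have mf : measurable_fun setT
    (fun z : T * T => (vadd n z.1 (g z.2), z.2)).
  apply: measurable_fun_pair; last exact: measurable_snd.
  apply: (measurableT_comp (measurable_vadd n) (g := fun z : T * T => (z.1, g z.2))).
  apply: measurable_fun_pair; first exact: measurable_fst.
  by apply: (measurableT_comp mg); exact: measurable_snd.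
rewrite [LHS](integral_xsection_ysection mu mu _ (measurable_preimageT mf mW)).
rewrite [RHS](integral_xsection_ysection mu mu _ mW).
apply: eq_integral => h _.
rewrite -(leb_vadd n (g h) _ (measurable_ysection _ mW)); congr (mu _).
by apply/seteqP; split => x; rewrite !ysectionE/= vaddC.
Qed.

Lemma prodm_shear2 (W : set (T * T)) : measurable W ->
  M ((fun z => (z.1, vadd n z.1 z.2)) @^-1` W) = M W.
Proof.
move=> mW; apply: eq_integral => x _.
rewrite -[RHS](leb_vadd n x _ (measurable_xsection _ mW)) /=.
by rewrite !xsectionE.
Qed.

(** The shear [(x, h) -> (x + h, h)] preserves measure and sends the pairs into the product of [E]
    and [S]. *)
Lemma corr_le_mul A E S : measurable A -> measurable E -> measurable S ->
  M (corr A E S) <= mu E * mu S.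
Proof.
move=> mA mE mS; have mES : measurable (E `*` S) by exact: measurableX.
have -> : mu E * mu S = M (E `*` S) by rewrite /prodm product_measure1E.
rewrite -[leRHS](@prodm_shear1 id)//.
apply: le_measure; rewrite ?inE.
- exact: measurable_corr.
- apply: (measurable_preimageT _ mES); apply: measurable_fun_pair.
    exact: measurable_vadd.
  exact: measurable_snd.
- by move=> z [? ? ?]; split.
Qed.

(** The shear [(x, h) -> (x, x + h)] preserves measure and sends the pairs into the product of [A]
    and [E]; the bound does not depend on the size of [S]. *)
Lemma corr_le_mulr A E S : measurable A -> measurable E -> measurable S ->
  M (corr A E S) <= mu A * mu E.
Proof.
move=> mA mE mS; have mAE : measurable (A `*` E) by exact: measurableX.
have -> : mu A * mu E = M (A `*` E) by rewrite /prodm product_measure1E.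
rewrite -[leRHS]prodm_shear2//.
apply: le_measure; rewrite ?inE.
- exact: measurable_corr.
- apply: (measurable_preimageT _ mAE); apply: measurable_fun_pair.
    exact: measurable_fst.
  exact: measurable_vadd.
- by move=> z [? ? ?]; split.
Qed.

Lemma corr_mul_le A S : measurable A -> measurable S ->
  mu A * mu S <= M (corr A A S) + M (corr A (~` A) S).
Proof.
move=> mA mS.
have -> : mu A * mu S = M (A `*` S) by rewrite /prodm product_measure1E.
apply: le_trans (measureU2 _ _ _); [|apply: measurable_corr => //; exact: measurableC..].
apply: le_measure; rewrite ?inE.
- exact: measurableX.
- by apply: measurableU; apply: measurable_corr => //; exact: measurableC.
- by move=> z [? ?]; have [?|?] := pselect (A (vadd n z.1 z.2)); [left|right].
Qed.

Lemma corr_setU A E F S : measurable A -> measurable E -> measurable F ->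
  measurable S -> M (corr A (E `|` F) S) <= M (corr A E S) + M (corr A F S).
Proof.
move=> mA mE mF mS.
apply: le_trans (measureU2 _ _ _); [|exact: measurable_corr..].
apply: le_measure; rewrite ?inE.
- by apply: measurable_corr => //; exact: measurableU.
- by apply: measurableU; apply: measurable_corr.
- by move=> z [? ? [?|?]]; [left|right].
Qed.

(* A translation by h that leaves A leaves it during one of two translations by
   h/2, so |A \ (A - h)| <= 2 |A \ (A - h/2)|. *)
Lemma corr_halve A S S' : measurable A -> measurable S' ->
  vscale n 2^-1 @^-1` S' = S ->
  M (corr A (~` A) S) <= (2 ^+ n.+2)%:E * M (corr A (~` A) S').
Proof.
move=> mA mS' SS'.
have mS : measurable S.
  by rewrite -SS'; exact: (measurable_preimageT (measurable_vscale n _)).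
have mCA : measurable (~` A) by exact: measurableC.
pose W := (fun z : T * T => (z.1, vscale n 2^-1 z.2)) @^-1` corr A (~` A) S'.
have mW : measurable W.
  apply: (measurable_preimageT _ (measurable_corr _ _ _ mA mCA mS')).
  apply: measurable_fun_pair; first exact: measurable_fst.
  by apply: (measurableT_comp (measurable_vscale n _)); exact: measurable_snd.
have MW : M (corr A (~` A) S') = (1 * 2^-1 ^+ n.+1)%:E * M W.
  apply: (prodm_scaled_preimage mu mu id) => //.
  - exact: measurable_vscale.
  - by move=> B mB; rewrite mul1e.
  - by move=> B mB; exact: leb_vscale.
  - exact: measurable_corr.
pose W' := (fun z : T * T => (vadd n z.1 (vscale n 2^-1 z.2), z.2)) @^-1` W.
have mf : measurable_fun setT
    (fun z : T * T => (vadd n z.1 (vscale n 2^-1 z.2), z.2)).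
  apply: measurable_fun_pair; last exact: measurable_snd.
  apply: (measurableT_comp (measurable_vadd n)
    (g := fun z : T * T => (z.1, vscale n 2^-1 z.2))).
  apply: measurable_fun_pair; first exact: measurable_fst.
  by apply: (measurableT_comp (measurable_vscale n _)); exact: measurable_snd.
have mW' : measurable W' by exact: measurable_preimageT.
have MW' : M W' = M W by apply: prodm_shear1 => //; exact: measurable_vscale.
(* [W] holds the pairs whose first half-step leaves [A], [W'] those whose second one does. Each has
   [2 ^ (n + 1)] times the measure of the pairs with displacement in [S']. *)
have -> : (2 ^+ n.+2)%:E * M (corr A (~` A) S') = M W + M W'.
  rewrite MW' MW muleA -EFinM mul1r exprS exprVn -mulrA divff ?mulr1.
    by rewrite mulr2n EFinD ge0_muleDl// mul1e.
  by rewrite expf_neq0.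
apply: le_trans (measureU2 _ _ _) => //.
apply: le_measure; rewrite ?inE.
- exact: measurable_corr.
- exact: measurableU.
move=> [x h] [/= Ax Sh nAxh].
have [Axh|nA] := pselect (A (vadd n x (vscale n 2^-1 h))); last first.
  by left; split => //=; rewrite -[S' _]/((vscale n 2^-1 @^-1` S') h) SS'.
right; split => //=; first by rewrite -[S' _]/((vscale n 2^-1 @^-1` S') h) SS'.
by rewrite -vaddA vscale_half.
Qed.

Definition shell (r : R) : set T := cube n r `\` cube n (r / 2).

Lemma measurable_shell r : measurable (shell r).
Proof. by apply: measurableD; exact: measurable_cube. Qed.

Lemma preimage_vscale_shell k r : (0 < k)%R ->
  vscale n k @^-1` shell r = shell (r / k)%R.
Proof.
move=> k0; rewrite /shell -[LHS]/((vscale n k @^-1` cube n r) `\`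
  (vscale n k @^-1` cube n (r / 2))) !preimage_vscale_cube//.
by congr (_ `\` cube n _); field; exact: lt0r_neq0.
Qed.

Lemma leb_shell r : (0 <= r)%R ->
  mu (shell r) = ((2 * r) ^+ n.+1 * (1 - 2^-1 ^+ n.+1))%:E.
Proof.
move=> r0; have r20 : (0 <= r / 2)%R by lra.
rewrite measureD; [|exact: measurable_cube..|by rewrite [ltLHS](leb_cube n _ r0) ltry].
rewrite setIidr; last by apply: subset_cube; lra.
rewrite [X in X - _](leb_cube n _ r0) [X in _ - X](leb_cube n _ r20) -EFinB.
by congr EFin; rewrite mulrBr mulr1 -exprMn; congr (_ - _ ^+ _)%R; field.
Qed.

(** Each of the [j] halvings costs [2 ^ (n + 2)]: [n + 1] factors 2 for the volume of the shell and
    one for the two half-steps. *)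
Lemma corr_shell_iter A r j : measurable A ->
  M (corr A (~` A) (shell r)) <=
  (2 ^+ (n.+2 * j))%:E * M (corr A (~` A) (shell (r / 2 ^+ j))).
Proof.
move=> mA; elim: j => [|j IH]; first by rewrite muln0 !expr0 divr1 mul1e.
apply: (le_trans IH); rewrite mulnS addnC exprD EFinM -muleA.
apply: lee_wpmul2l; first by rewrite lee_fin exprn_ge0.
apply: corr_halve => //; first exact: measurable_shell.
rewrite preimage_vscale_shell; last by rewrite invr_gt0.
congr shell; rewrite exprS; field.
by rewrite expf_neq0.
Qed.

(** The outer shell has measure [4 a q] with [q >= 1/2]. Among its pairs starting in [A], of measure
    [4 a^2 q], at most [a^2] end in [A]; the others pass to the [j]-th shell with the factor
    [2 ^ (- (n + 2) j)]. On that shell the pairs ending in [B] have measure at most [a^2 q] times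
    the same factor, because [2 ^ j * 4 b <= a]. What remains is [(3 q - 1) a^2 >= a^2 / 2] times
    this factor. *)
Lemma corr_shell_ge A B (a b r : R) (j : nat) :
  measurable A -> measurable B -> A `&` B = set0 ->
  mu A = a%:E -> mu B = b%:E -> (0 < r)%R ->
  ((2 * r) ^+ n.+1 = 4 * a)%R -> (2 ^+ j * (4 * b) <= a)%R ->
  (a ^+ 2 / 2 / 2 ^+ (n.+2 * j))%:E <=
    M (corr A (~` (A `|` B)) (shell (r / 2 ^+ j))).
Proof.
move=> mA mB AB Aa Bb r0 ra jab.
have a0 : (0 < a)%R.
  have := exprn_gt0 n.+1 (mulr_gt0 (ltr0n R 2) r0); lra.
set Sj := shell _.
have mSj : measurable Sj by exact: measurable_shell.
have mS : measurable (shell r) by exact: measurable_shell.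
have mD : measurable (~` (A `|` B)) by apply: measurableC; exact: measurableU.
have mCA : measurable (~` A) by exact: measurableC.
pose q : R := (1 - 2^-1 ^+ n.+1)%R.
have q2 : (2^-1 <= q <= 1)%R.
  have : (2^-1 ^+ n.+1 <= 2^-1 :> R)%R.
    by rewrite -[leRHS]expr1 ler_wiXn2l// ?invr_ge0// invf_le1// ler1n.
  have : (0 <= 2^-1 ^+ n.+1 :> R)%R by rewrite exprn_ge0// invr_ge0.
  rewrite /q; lra.
have muS : mu (shell r) = (4 * a * q)%:E by rewrite leb_shell ?ltW// ra.
have muSj : mu Sj = (4 * a * q / 2 ^+ (n.+1 * j))%:E.
  rewrite leb_shell; last by rewrite divr_ge0 ?exprn_ge0// ltW.
  congr EFin; rewrite -/q mulrA expr_div_n ra -exprM mulnC; ring.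
clearbody q.
(* All the measures involved are finite, so that the rest of the argument takes place in the
   reals. *)
have finM (x : \bar R) (y : R) : 0 <= x -> x <= y%:E -> x = (fine x)%:E.
  by move=> x0 xy; rewrite fineK// ge0_fin_numE// (le_lt_trans xy)// ltry.
have corr_fin E S (y : R) : measurable E -> measurable S -> mu S = y%:E ->
    exists z, M (corr A E S) = z%:E.
  move=> mE mS' Sy; exists (fine (M (corr A E S))); apply: (finM _ (a * y)%R) => //.
  rewrite EFinM -Aa -Sy -[leRHS](product_measure1E mu mu mA mS').
  apply: le_measure; rewrite ?inE; [exact: measurable_corr|exact: measurableX|].
  by move=> z [? ? ?].
have [d dE] := corr_fin _ _ _ mD mSj muSj.
have [e eE] := corr_fin _ _ _ mB mSj muSj.
have [f fE] := corr_fin _ _ _ mCA mSj muSj.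
have [m mE] := corr_fin _ _ _ mCA mS muS.
have [p pE] := corr_fin _ _ _ mA mS muS.
have H1 := corr_mul_le _ _ mA mS; rewrite Aa muS pE mE -EFinM -EFinD lee_fin in H1.
have H2 := corr_le_mulr _ _ _ mA mA mS; rewrite Aa pE -EFinM lee_fin in H2.
have H3 := corr_shell_iter _ r j mA; rewrite -/Sj fE mE -EFinM lee_fin in H3.
have H4 := corr_le_mul _ _ _ mA mB mSj; rewrite Bb muSj eE -EFinM lee_fin in H4.
have H5 := corr_setU _ _ _ _ mA mD mB mSj.
have CA : ~` (A `|` B) `|` B = ~` A.
  apply/seteqP; split => x /=; first move=> [nAB|Bx] Ax.
  - by apply: nAB; left.
  - by have : (A `&` B) x by []; rewrite AB.
  - by move=> nA; have [Bx|nB] := pselect (B x); [right|left => -[]].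
rewrite CA dE eE fE -EFinD lee_fin in H5.
rewrite dE lee_fin ler_pdivrMr ?exprn_gt0//.
(* The volume of the [j]-th shell accounts for [2 ^ ((n + 1) j)], the loss under halving for
   [2 ^ j]. *)
have E2 : (2 ^+ (n.+2 * j) = 2 ^+ (n.+1 * j) * 2 ^+ j :> R)%R.
  by rewrite -exprD; congr (_ ^+ _)%R; rewrite [n.+2]lock mulSn -lock addnC.
have u0 : (0 < 2 ^+ (n.+1 * j) :> R)%R by rewrite exprn_gt0.
have v0 : (0 < 2 ^+ j :> R)%R by rewrite exprn_gt0.
rewrite E2 in H3 *.
set u := (2 ^+ (n.+1 * j))%R in u0 H3 H4 *; set v := (2 ^+ j)%R in v0 jab H3 *.
have H6 : (e * (u * v) <= v * b * (4 * a * q))%R.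
  have -> : (v * b * (4 * a * q) = b * (4 * a * q / u) * (u * v))%R.
    by field; exact: lt0r_neq0.
  by rewrite ler_wpM2r// mulr_ge0// ltW.
have H7 : (v * (4 * b) * (a * q) <= a * (a * q))%R.
  by rewrite ler_wpM2r// mulr_ge0//; lra.
have /andP[q2l q2r] := q2.
have H8 : (a * a * 2^-1 <= a * a * q)%R.
  by rewrite ler_wpM2l// mulr_ge0// ltW.
have H9 : (f * (u * v) <= (d + e) * (u * v))%R by rewrite ler_wpM2r// mulr_ge0// ltW.
nra.
Qed.

End correlation.

(** * Lower bounds in every dimension *)

Section kernel.
Local Open Scope ereal_scope.
Context {R : realType} (n : nat) (s : R).
Hypothesis s0 : (0 < s)%R.
Notation T := (Rn R n).
Notation mu := (leb R n).
Notation M := (prodm (leb R n) (leb R n)).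
Notation p := (n.+1%:R + 2 * s)%R.

Definition ker (x y : T) : \bar R :=
  if (Defs.edist x y == 0)%R then +oo else (Defs.edist x y `^ (- p))%:E.

Lemma ker_ge0 x y : 0 <= ker x y.
Proof. by rewrite /ker; case: ifP => // _; rewrite lee_fin powR_ge0. Qed.

Lemma measurable_ker : measurable_fun setT (fun z : T * T => ker z.1 z.2).
Proof.
apply: measurable_fun_ifT => /=.
- apply: measurable_fun_eqr => //; exact: measurable_edist.
- exact: measurable_cst.
- apply/measurable_EFinP.
  by apply: (measurableT_comp (measurable_powR _)); exact: measurable_edist.
Qed.

Lemma measurable_kerl x : measurable_fun setT (ker x).
Proof.
have -> : ker x = (fun z : T * T => ker z.1 z.2) \o pair x by [].
by apply: (measurableT_comp measurable_ker); exact: pair1_measurable.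
Qed.

Lemma ker_ge x y (u : R) : (0 < u)%R -> (Defs.edist x y <= u)%R ->
  (u `^ (- p))%:E <= ker x y.
Proof.
move=> u0 xyu; rewrite /ker; case: eqP => [_|/eqP xy0]; first by rewrite leey.
rewrite lee_fin powRN_le// ?addr_ge0 ?mulr_ge0 ?ltW//.
by rewrite lt_def xy0 sqrtr_ge0.
Qed.

Lemma measurable_integral_ker (D : set T) : measurable D ->
  measurable_fun setT (fun x => \int[mu]_(y in D) ker x y).
Proof.
move=> mD; pose f := (fun z : T * T => ker z.1 z.2) \_ (setT `*` D).
have -> : (fun x => \int[mu]_(y in D) ker x y) = fubini_F mu f.
  apply/funext => x; rewrite integral_mkcond; apply: eq_integral => y _.
  by rewrite /f /patch in_setX in_setT.
apply: measurable_fun_fubini_tonelli_F; last first.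
  by move=> z; apply: erestrict_ge0 => w _; exact: ker_ge0.
apply/(measurable_restrictT _ _).1; first exact: measurableX.
by apply: measurable_funTS; exact: measurable_ker.
Qed.

(** For a displacement in [S i] the distance is at most [(n + 1) r i], which bounds the kernel from
    below by a constant; Tonelli then turns the integral over [x] into the measure of the pairs. *)
Lemma Lint_ge_corr (A D : set T) (J : nat) (S : nat -> set T) (r : nat -> R) :
  measurable A -> measurable D -> (forall i, measurable (S i)) ->
  trivIset setT S -> (forall i, (0 < r i)%R) ->
  (forall i, S i `<=` cube n (r i)) ->
  \sum_(0 <= i < J) ((n.+1%:R * r i) `^ (- p))%:E * M (corr n A D (S i)) <=
  Lint s A D.
Proof.
move=> mA mD mS tS r0 Sr.
pose c i := ((n.+1%:R * r i) `^ (- p))%R.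
have c0 i : (0 <= c i)%R by exact: powR_ge0.
have mcorr i : measurable (corr n A D (S i)) by exact: measurable_corr.
have mX i : measurable_fun setT (fun x => mu (xsection (corr n A D (S i)) x)).
  exact: (measurable_fun_xsection mu (mcorr i)).
have -> : \sum_(0 <= i < J) (c i)%:E * M (corr n A D (S i)) =
    \int[mu]_x (\sum_(0 <= i < J) (c i)%:E * mu (xsection (corr n A D (S i)) x)).
  rewrite ge0_integral_sum//.
  - by apply: eq_bigr => i _; rewrite ge0_integralZl ?lee_fin.
  - by move=> i; exact: measurable_funeM.
  - by move=> i x _; rewrite mule_ge0// lee_fin.
have -> : Lint s A D = \int[mu]_(x in A) \int[mu]_(y in D) ker x y by [].
rewrite [leRHS]integral_mkcond; apply: ge0_le_integral => //.
- by move=> x _; apply: sume_ge0 => i _; rewrite mule_ge0// lee_fin.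
- by apply: emeasurable_sum => i _; exact: measurable_funeM.
- apply/(measurable_restrictT _ _).1 => //; apply: measurable_funTS.
  exact: measurable_integral_ker.
move=> x _; rewrite /patch; case: ifPn => [/set_mem Ax|/negP nA]; last first.
  rewrite big1// => i _; rewrite (_ : xsection _ x = set0) ?measure0 ?mule0//.
  apply/seteqP; split => h//; rewrite xsectionE => -[/= Ax _ _].
  by apply: nA; rewrite inE.
(* [F i] consists of the endpoints [y = x + h] in [D] with [h] in [S i]; it is a translate of the
   section of the set of pairs at [x]. *)
pose F i := D `&` (vadd n (vscale n (-1) x) @^-1` S i).
have mF i : measurable (F i).
  by apply: measurableI => //; exact: (measurable_preimageT (measurable_vaddl n _)).
have FE i : mu (xsection (corr n A D (S i)) x) = mu (F i).
  rewrite -(leb_vadd n x _ (mF i)); congr (mu _); apply/seteqP; split => h;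
    rewrite xsectionE /=.
  - by case=> _ Sh Dh; split => //=; rewrite vaddK.
  - by case=> Dh /=; rewrite vaddK.
have tF : trivIset setT F.
  apply/trivIsetP => i j _ _ ij; apply/seteqP; split => y //= [[_ Si] [_ Sj]].
  have /trivIsetP/(_ i j Logic.I Logic.I ij) := tS => Sij.
  have : (S i `&` S j) (vadd n (vscale n (-1) x) y) by [].
  by rewrite Sij.
under eq_bigr do rewrite FE.
apply: ge0_integral_ge_sum => //.
- exact: measurable_kerl.
- by move=> y; exact: ker_ge0.
- by move=> i _ y [].
move=> i _ y [Dy /= Sy].
have -> : y = vadd n x (vadd n (vscale n (-1) x) y).
  by rewrite vaddA (vaddC n x) -vaddA vaddK.
apply: ker_ge; first by rewrite mulr_gt0.
by apply: edist_vadd_cube; [exact: ltW|exact: Sr].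
Qed.

End kernel.

(** * Estimates from one cube and from dyadic shells *)

Section lower_bounds.
Context {R : realType} (n : nat) (s : R).
Hypothesis s0 : 0 < s.
Notation T := (Rn R n).
Notation mu := (leb R n).
Notation M := (prodm (leb R n) (leb R n)).
Notation N := (n.+1%:R : R).
Notation p := (n.+1%:R + 2 * s).

Lemma powR_root_exp (v : R) : 0 <= v -> (v `^ N^-1) ^+ n.+1 = v.
Proof.
move=> v0; rewrite -powR_mulrn ?powR_ge0// -powRrM.
by rewrite mulVf ?pnatr_eq0// powRr1.
Qed.

(** Here [v] is the volume of the cube of half-side [v ^ (1/N) / 2]. *)
Lemma ker_cube_radius (v : R) : 0 < v ->
  (N * (v `^ N^-1 / 2)) `^ (- p) = (N / 2) `^ (- p) * v `^ (- (p / N)).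
Proof.
move=> v0; have -> : N * (v `^ N^-1 / 2) = N / 2 * v `^ N^-1 by ring.
rewrite powRM ?powR_ge0//.
rewrite -powRrM; congr (_ * _ `^ _); by rewrite mulrN mulrC.
Qed.

Definition cube_constant : R := (N / 2) `^ (- p) * 2 `^ (- (p / N)).

(** The factor [1/2] comes from [corr_shell_ge], the power of 4 from the volume [4 a] of the largest
    cube; the power of 2 in [cube_constant] comes likewise from the volume [2 (a + b)]. *)
Definition shell_constant : R := 2^-1 * (N / 2) `^ (- p) * 4 `^ (- (p / N)).

Lemma cube_constant_gt0 : 0 < cube_constant.
Proof. by rewrite mulr_gt0// powR_gt0// divr_gt0. Qed.

Lemma shell_constant_gt0 : 0 < shell_constant.
Proof. by rewrite !mulr_gt0 ?invr_gt0 ?powR_gt0// divr_gt0. Qed.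

(** In a cube of volume [2 (a + b)] centred at a point of [A], the sets [A] and [B] occupy at most
    half, so [D] fills the rest. *)
Lemma Lint_ge_total (A B : set T) (a b : R) :
  measurable A -> measurable B -> mu A = a%:E -> mu B = b%:E -> 0 < a -> 0 <= b ->
  ((cube_constant * (a * (a + b) `^ (- (2 * s) / N)))%:E
    <= Lint s A (~` (A `|` B)))%E.
Proof.
move=> mA mB Aa Bb a0 b0.
set D := ~` (A `|` B).
have mD : measurable D by apply: measurableC; exact: measurableU.
pose v := 2 * (a + b); have v0 : 0 < v by rewrite /v; lra.
pose r := v `^ N^-1 / 2; have r0 : 0 < r by rewrite divr_gt0// powR_gt0.
(* Only one layer is used; the others are empty. *)
pose S (i : nat) := if i is 0 then cube n r else set0.
have mS i : measurable (S i).
  by case: i => [|i] /=; [exact: measurable_cube|exact: measurable0].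
have tS : trivIset setT S.
  by apply/trivIsetP => -[|i] [|j] //= _ _ _; rewrite ?set0I ?setI0.
have Sr i : S i `<=` cube n r by case: i => [|i] //=; exact: sub0set.
have := Lint_ge_corr n s s0 A D 1 S (fun=> r) mA mD mS tS (fun=> r0) Sr.
rewrite big_nat1 ker_cube_radius//; apply: le_trans.
have muQ : mu (cube n r) = v%:E.
  rewrite leb_cube ?ltW//; congr EFin.
  by rewrite /r mulrC divfK// powR_root_exp// ltW.
set x := M _.
have H : ((a * v)%:E <= (a * a)%:E + (x + (a * b)%:E))%E.
  have := @corr_mul_le R n A (cube n r) mA (measurable_cube n r).
  rewrite Aa muQ -EFinM => /le_trans; apply; apply: leeD.
    rewrite EFinM -Aa; apply: corr_le_mulr => //; exact: measurable_cube.
  apply: (@le_trans _ _ (M (corr n A (D `|` B) (cube n r)))).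
    apply: le_measure; rewrite ?inE.
    - apply: measurable_corr => //; [exact: measurableC|exact: measurable_cube].
    - apply: measurable_corr => //; [exact: measurableU|exact: measurable_cube].
    move=> z [Az Qz nA]; split => //.
    by have [Bz|nB] := pselect (B (vadd n z.1 z.2)); [right|left => -[]].
  apply: le_trans (corr_setU _ _ _ _ _ _ _ _ _) _ => //; first exact: measurable_cube.
  apply: leeD => //.
  rewrite EFinM -Aa -Bb; apply: corr_le_mulr => //; exact: measurable_cube.
have {}H : ((a * (a + b))%:E <= x)%E.
  case: x H => [x| |] //= H; last by rewrite leey.
  by move: H; rewrite -!EFinD !lee_fin /v; nra.
apply: le_trans (lee_wpmul2l _ H); last first.
  by rewrite lee_fin mulr_ge0 ?powR_ge0.
have ab0 : 0 < a + b by lra.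
rewrite -EFinM lee_fin /v /cube_constant (powRM _ (ler0n _ 2) (ltW ab0)).
have -> : - (p / N) = - (2 * s) / N - 1.
  have : N != 0 by rewrite pnatr_eq0.
  by move: (N) => m m0; field.
rewrite [in leRHS](powRDg (a + b))// powR_inv1; last by rewrite ltW.
rewrite le_eqVlt; apply/orP; left; apply/eqP; field; exact: lt0r_neq0.
Qed.

Lemma trivIset_shell (r : R) : 0 <= r ->
  trivIset setT (fun j => shell n (r / 2 ^+ j)).
Proof.
move=> r0; apply: ltn_trivIset => j i ij; apply/seteqP; split => x //= [[_ +] [+ _]].
apply: contra_not; apply: subset_cube.
rewrite -mulrA -invfM -exprSr ler_wpM2l// lef_pV2 ?posrE ?exprn_gt0//.
by rewrite ler_eXn2l// ltr1n.
Qed.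

(** On the [j]-th shell the kernel gains [2 ^ (j p)] and the measure of the pairs loses
    [2 ^ ((n + 2) j)]; as [p = (n + 2) + (2 s - 1)], the net factor is [2 ^ (j (2 s - 1))]. The
    condition on [J] makes all shells up to [J] admissible. *)
Lemma Lint_ge_dyadic (A B : set T) (a b : R) (J : nat) :
  measurable A -> measurable B -> A `&` B = set0 ->
  mu A = a%:E -> mu B = b%:E -> 0 < a -> 0 <= b -> 2 ^+ J * (4 * b) <= a ->
  ((shell_constant * (a `^ ((N - 2 * s) / N) *
    \sum_(0 <= j < J.+1) (2 `^ (2 * s - 1)) ^+ j))%:E <= Lint s A (~` (A `|` B)))%E.
Proof.
move=> mA mB AB Aa Bb a0 b0 Jab.
set D := ~` (A `|` B).
have mD : measurable D by apply: measurableC; exact: measurableU.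
have v0 : 0 < 4 * a by lra.
pose r := (4 * a) `^ N^-1 / 2; have r0 : 0 < r by rewrite divr_gt0// powR_gt0.
have rE : (2 * r) ^+ n.+1 = 4 * a.
  by rewrite /r mulrC divfK// powR_root_exp// ltW.
apply: le_trans (Lint_ge_corr n s s0 A D J.+1 (fun j => shell n (r / 2 ^+ j))
  (fun j => r / 2 ^+ j) mA mD _ _ _ _); last 4 first.
- by move=> i; exact: measurable_shell.
- by apply: trivIset_shell; exact: ltW.
- by move=> i; rewrite divr_gt0// exprn_gt0.
- by move=> i x [].
rewrite !mulr_sumr -sumEFin big_nat_cond [leRHS]big_nat_cond.
apply: lee_sum => j /andP[/andP[_ jJ] _].
have jab : 2 ^+ j * (4 * b) <= a.
  apply: le_trans Jab; rewrite ler_wpM2r//; first lra.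
  by rewrite ler_eXn2l// ltr1n.
have := corr_shell_ge n A B a b r j mA mB AB Aa Bb r0 rE jab.
move/(lee_wpmul2l (x := ((N * (r / 2 ^+ j)) `^ (- p))%:E)).
rewrite lee_fin powR_ge0 => /(_ erefl); apply: le_trans.
rewrite -EFinM lee_fin le_eqVlt; apply/orP; left; apply/eqP.
have k0 : 0 < 2 ^+ j :> R by rewrite exprn_gt0.
have Nr0 : 0 <= N * r by rewrite mulr_ge0// ltW.
have kV0 : 0 <= (2 ^+ j)^-1 :> R by rewrite invr_ge0 ltW.
rewrite [N * (r / _)]mulrA (powRM _ Nr0 kV0) ker_cube_radius//.
rewrite (powRM _ (ler0n _ 4) (ltW a0)).
have -> : (2 ^+ j)^-1 `^ (- p) = (2 ^+ j) `^ (2 * s - 1) * 2 ^+ (n.+2 * j) :> R.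
  rewrite powRN -[(2 ^+ j)^-1]powR_inv1 ?ltW// -powRrM mulN1r powRN invrK.
  have -> : p = (2 * s - 1) + n.+2%:R by rewrite -[in RHS]natr1; ring.
  by rewrite powRDg// powR_mulrn ?ltW// -exprM mulnC.
have -> : (2 ^+ j) `^ (2 * s - 1) = (2 `^ (2 * s - 1)) ^+ j :> R.
  by rewrite -!powR_mulrn ?powR_ge0// powRAC.
have -> : a `^ ((N - 2 * s) / N) = a ^+ 2 * a `^ (- (p / N)).
  rewrite -powR_mulrn ?ltW// -powRDg//; congr (_ `^ _).
  have : N != 0 by rewrite pnatr_eq0.
  by move: (N) => m m0; field.
by rewrite /shell_constant; field; rewrite expf_neq0.
Qed.

End lower_bounds.

(** * A sharp bound on the line *)

Section one_dimensional.
Context {R : realType}.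
Notation mu := (@lebesgue_measure R).
Notation RR := (measurableTypeR R).

Lemma cvg_powRN_pinfty (e : R) : 0 < e -> x `^ (- e) @[x --> +oo] --> (0 : R).
Proof.
move=> e0; apply/cvgrPdist_lt => /= eps eps0.
near=> x.
have x0 : 0 < x by near: x; exact: nbhs_pinfty_gt.
rewrite sub0r normrN ger0_norm ?powR_ge0// powRN.
rewrite -[ltRHS]invrK ltf_pV2 ?posrE ?powR_gt0 ?invr_gt0//.
have -> : eps^-1 = (eps^-1 `^ e^-1) `^ e.
  by rewrite -powRrM mulVf ?lt0r_neq0// powRr1// invr_ge0 ltW.
apply: gt0_ltr_powR => //; rewrite ?nnegrE ?powR_ge0 ?(ltW x0)//.
Unshelve. all: by end_near. Qed.

Lemma integral_powR_tail (e w : R) : 0 < e -> 0 < w ->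
  (\int[mu]_(h in `[w, +oo[) (h `^ (- (1 + e)))%:E = (w `^ (- e) / e)%:E)%E.
Proof.
move=> e0 w0; pose F (x : R) : R := - e^-1 * x `^ (- e).
have dF (x : R) : 0 < x -> is_derive x (1:R) F (x `^ (- (1 + e))).
  move=> x0; have Dx := @is_derive1_powR R (- e) x x0.
  apply: is_derive_eq.
  rewrite /GRing.scale /= mulrA mulrNN mulVf ?lt0r_neq0// mul1r.
  by congr (_ `^ _); ring.
rewrite (@ge0_continuous_FTC2y R _ F w 0).
- by rewrite sub0e -EFinN /F mulNr opprK mulrC.
- by move=> x _; exact: powR_ge0.
- apply: derivable_within_continuous => x; rewrite in_itv/= andbT => wx.
  by apply: derivable_powR; rewrite in_itv/= andbT (lt_le_trans w0).
- by rewrite -[0](mulr0 (- e^-1)); apply: cvgMr; exact: cvg_powRN_pinfty.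
- by move=> x wx; have [] := dF x (lt_trans w0 wx).
- apply/cvg_at_right_filter.
  have [dFw _] := dF w w0.
  by apply: differentiable_continuous; apply/derivable1_diffP.
- move=> x; rewrite in_itv/= andbT => wx.
  by have [_ <-] := dF x (lt_trans w0 wx); rewrite derive1E.
Qed.

Lemma edist0E (x y : Rn R 0) : Defs.edist x y = `|(x : R) - (y : R)|.
Proof. exact: sqrtr_sqr. Qed.

(** The kernel decreases with the distance, so the worst case is that [D] misses exactly the
    interval of length [w] next to [x], which leaves the tail integral. The map [phi] parametrizes
    the half-line by the distance to [x], so that both sides are treated at once. *)
Lemma integral_ker_halfline_ge (s w : R) (x : RR) (phi : RR -> RR) (D H : set RR) :
  0 < s -> 0 < w -> measurable_fun setT phi ->
  (forall A, measurable A -> mu (phi @^-1` A) = mu A) ->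
  measurable D -> measurable H -> phi @^-1` H = `]0, +oo[%classic ->
  (forall h : R, 0 < h -> `|(x : R) - phi h| = h) ->
  (mu (H `\` D) <= w%:E)%E ->
  ((w `^ (- (2 * s)) / (2 * s))%:E <=
    \int[mu]_(y in D `&` H) ker 0 s (x : Rn R 0) y)%E.
Proof.
move=> s0 w0 mphi phimu mD mH phiH phix HD.
have s20 : 0 < 2 * s by lra.
have mDH : measurable (D `&` H) by exact: measurableI.
have mk : measurable_fun setT (ker 0 s (x : Rn R 0)) by exact: measurable_kerl.
pose G := phi @^-1` D.
have mG : measurable G by exact: (measurable_preimageT mphi).
pose f (h : RR) := (h `^ (- (1 + 2 * s)))%:E.
have mf : measurable_fun setT f.
  by apply/measurable_EFinP; exact: measurable_powR.
(* Change of variables: [phi] preserves Lebesgue measure. *)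
have -> : (\int[mu]_(y in D `&` H) ker 0 s (x : Rn R 0) y =
    \int[mu]_(h in G `&` `]0%R, +oo[) f h)%E.
  transitivity (\int[pushforward mu phi]_(y in D `&` H) ker 0 s (x : Rn R 0) y)%E.
    by apply: eq_measure_integral => B mB _; rewrite /pushforward -[LHS]phimu.
  rewrite ge0_integral_pushforward//; first last.
  - by move=> y _; exact: ker_ge0.
  - exact: measurable_funTS.
  rewrite preimage_setI phiH; apply: eq_integral => h.
  rewrite inE => -[_ /=]; rewrite ?in_itv/= andbT => h0.
  by rewrite /ker edist0E phix// gt_eqF.
pose J : set RR := `]0, w[%classic; pose U : set RR := `[w, +oo[%classic.
have mJ : measurable J by exact: measurable_itv.
have mU : measurable U by exact: measurable_itv.
have JU : J `&` U = set0.
  apply/seteqP; split => h //; rewrite /J /U /= !in_itv/= andbT.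
  by move=> [/andP[_ hw] /(lt_le_trans hw)]; rewrite ltxx.
have JUE : J `|` U = `]0, +oo[%classic.
  apply/seteqP; split => h; rewrite /J /U /= !in_itv/= !andbT.
    by move=> [/andP[]//|/(lt_le_trans w0)].
  by move=> h0; case: (ltP h w) => hw; [left; rewrite h0|right].
rewrite -(integral_powR_tail _ _ s20 w0) -JUE.
apply: (@bathtub_integral_le _ _ _ mu G J U f (w `^ (- (1 + 2 * s)))) => //.
- by move=> h; rewrite lee_fin powR_ge0.
- exact: powR_ge0.
- move=> h; rewrite /J /= in_itv/= => /andP[h0 hw].
  by rewrite lee_fin powRN_le ?(ltW hw)//; lra.
- move=> h; rewrite /U /= in_itv/= andbT => wh.
  by rewrite lee_fin powRN_le//; lra.
(* [J] and [U] together lack at most [w = |J|] of [G], hence what [U] lacks is at most what [J]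
   retains. *)
have muJ : mu J = w%:E.
  by rewrite lebesgue_measure_itv/= lte_fin w0 sube0.
have mJG : measurable (J `\` G) by exact: measurableD.
have mUG : measurable (U `\` G) by exact: measurableD.
have H1 : (mu (J `\` G) + mu (U `\` G) <= w%:E)%E.
  apply: le_trans HD; rewrite -(phimu (H `\` D)); last exact: measurableD.
  rewrite -measureU//.
    apply: le_measure; rewrite ?inE.
    - exact: measurableU.
    - by apply: (measurable_preimageT mphi); exact: measurableD.
    rewrite -setDUl JUE -phiH => h [Hh nD]; split => //.
  apply/seteqP; split => h // [[Jh _] [Uh _]].
  by have : (J `&` U) h by []; rewrite JU.
have H2 : (w%:E = mu (J `&` G) + mu (J `\` G))%E.
  rewrite -muJ -measureU ?setUIDK//; first exact: measurableI.
  by apply/seteqP; split => h // [[_ Gh] [_ /(_ Gh)]].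
have fJG : mu (J `\` G) \is a fin_num.
  rewrite ge0_fin_numE//; apply: (@le_lt_trans _ _ w%:E); last exact: ltry.
  rewrite -muJ; apply: le_measure; rewrite ?inE//; exact: subDsetl.
rewrite -(leeD2rE _ _ fJG) -H2 addeC; exact: H1.
Qed.

(** * The distribution of mass along the line *)

Section right_mass.
Variables (A : set RR) (a : R).
Hypotheses (mA : measurable A) (Aa : mu A = a%:E).

Definition right_mass (x : R) : R := fine (mu (A `&` `]x, +oo[)).

Lemma measure_finI (I : set RR) : measurable I -> mu (A `&` I) \is a fin_num.
Proof.
move=> mI; rewrite ge0_fin_numE//; apply: (@le_lt_trans _ _ a%:E); last exact: ltry.
rewrite -Aa; apply: le_measure; rewrite ?inE//; exact: measurableI.
Qed.

Lemma right_massE x : mu (A `&` `]x, +oo[) = (right_mass x)%:E.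
Proof. by rewrite fineK//; apply: measure_finI; exact: measurable_itv. Qed.

Lemma left_massE x : mu (A `&` `]-oo, x]) = (a - right_mass x)%:E.
Proof.
have mI : measurable (A `&` `]-oo, x] : set RR).
  by apply: measurableI => //; exact: measurable_itv.
have mJ : measurable (A `&` `]x, +oo[ : set RR).
  by apply: measurableI => //; exact: measurable_itv.
rewrite EFinB -Aa -right_massE.
have -> : mu A = (mu (A `&` `]-oo, x]) + mu (A `&` `]x, +oo[))%E.
  rewrite -measureU//.
    rewrite -setIUr; congr (mu _); apply/esym/setIidl => y _.
    by have [yx|xy] := leP y x; [left|right]; rewrite /= in_itv/= ?andbT.
  apply/seteqP; split => y // [[_ /=]]; rewrite !in_itv/= andbT => yx [_ xy].
  by move: (le_lt_trans yx xy); rewrite ltxx.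
by rewrite addeK// right_massE.
Qed.

Lemma mid_massE x y : x <= y ->
  mu (A `&` `]x, y]) = (right_mass x - right_mass y)%:E.
Proof.
move=> xy.
have mI : measurable (A `&` `]x, y] : set RR).
  by apply: measurableI => //; exact: measurable_itv.
have mJ : measurable (A `&` `]y, +oo[ : set RR).
  by apply: measurableI => //; exact: measurable_itv.
rewrite EFinB -!right_massE.
have -> : mu (A `&` `]x, +oo[) = (mu (A `&` `]x, y]) + mu (A `&` `]y, +oo[))%E.
  rewrite -measureU//.
    by rewrite -setIUr -itv_bndbnd_setU.
  apply/seteqP; split => z // [[_ /=]]; rewrite !in_itv/= andbT => /andP[_ zy] [_ yz].
  by move: (le_lt_trans zy yz); rewrite ltxx.
by rewrite addeK// right_massE.
Qed.

Lemma right_mass_lip x y : x <= y -> 0 <= right_mass x - right_mass y <= y - x.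
Proof.
move=> xy; have H := mid_massE _ _ xy.
rewrite -!lee_fin -H measure_ge0/= EFinB.
apply: (@le_trans _ _ (mu (`]x, y] : set RR))).
  apply: le_measure; rewrite ?inE//.
  by apply: measurableI => //; exact: measurable_itv.
rewrite lebesgue_measure_itv/= lte_fin -EFinB; case: ifPn => //.
by rewrite lee_fin subr_ge0.
Qed.

Lemma right_mass_continuous : continuous right_mass.
Proof.
move=> x; apply/cvgrPdist_lt => e e0; near=> y.
apply: (@le_lt_trans _ _ `|x - y|); last first.
  by near: y; exact: (@cvgr_dist_lt _ _ _ (nbhs x) _ id x).
have [xy|yx] := leP x y.
  have /andP[h1 h2] := right_mass_lip _ _ xy.
  by rewrite ger0_norm// distrC ger0_norm// subr_ge0.
have /andP[h1 h2] := right_mass_lip _ _ (ltW yx).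
by rewrite distrC ger0_norm// ger0_norm// subr_ge0 ltW.
Unshelve. all: by end_near. Qed.

(** Continuity from below: the measures of the traces on [F k] converge to [a]. *)
Lemma measure_exhaust (F : nat -> set RR) (tau : R) : (forall k, measurable (F k)) ->
  nondecreasing_seq F -> \bigcup_k F k = setT -> tau < a ->
  exists k, (tau%:E < mu (A `&` F k))%E.
Proof.
move=> mF ndF FT ta; apply: contrapT => /forallNP H.
have mAF k : measurable (A `&` F k) by exact: measurableI.
have := @nondecreasing_cvg_mu _ _ _ mu (fun k => A `&` F k) mAF.
rewrite -setI_bigcupr FT setIT => /(_ mA) cv.
have {}cv : (mu \o (fun k => A `&` F k)) x @[x --> \oo] --> mu A.
  by apply: cv => i j ij; apply/subsetPset; apply: setIS; apply/subsetPset; exact: ndF.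
suff : (mu A <= tau%:E)%E by rewrite Aa lee_fin leNgt ta.
rewrite -(cvg_lim _ cv)//; apply: lime_le; first by apply/cvg_ex; exists (mu A).
by apply: nearW => k; rewrite leNgt; apply/negP; exact: H.
Qed.

(** Intermediate value theorem: far to the left the right mass exceeds [tau], far to the right it
    drops below. *)
Lemma right_mass_onto tau : 0 < tau < a -> exists x, right_mass x = tau.
Proof.
move=> /andP[t0 ta].
have [i Hi] : exists k, (tau%:E < mu (A `&` `](- k%:R)%R, +oo[))%E.
  apply: (measure_exhaust (fun k : nat => `](- k%:R)%R, +oo[%classic)) => //.
  - move=> i j ij; apply/subsetPset => x /=; rewrite !in_itv/= !andbT.
    by apply: le_lt_trans; rewrite lerN2 ler_nat.
  - apply/seteqP; split => x // _; exists (Num.truncn `|x|).+1 => //=.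
    rewrite in_itv/= andbT ltrNl (le_lt_trans (ler_norm _))// normrN.
    exact: truncnS_gt.
have [j Hj] : exists k, ((a - tau)%:E < mu (A `&` `]-oo, k%:R%R]))%E.
  apply: (measure_exhaust (fun k : nat => `]-oo, k%:R%R]%classic)) => //; last lra.
  - move=> i' j' ij; apply/subsetPset => x /=; rewrite !in_itv/=.
    by move=> /le_trans; apply; rewrite ler_nat.
  - apply/seteqP; split => x // _; exists (Num.truncn `|x|).+1 => //=.
    by rewrite in_itv/= (le_trans (ler_norm _))// ltW// truncnS_gt.
move: Hi Hj; rewrite right_massE left_massE !lte_fin => Hi Hj.
have ij : - i%:R <= j%:R :> R by rewrite (@le_trans _ _ 0)// oppr_le0.
have [| |x _ xt] := @IVT R right_mass (- i%:R) j%:R tau ij.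
- by apply: continuous_subspaceT; exact: right_mass_continuous.
- by rewrite ge_min le_max; apply/andP; split; apply/orP; [right|left]; lra.
by exists x.
Qed.

End right_mass.

End one_dimensional.

(** * Integration over slices of equal mass *)

Section one_dimensional_sharp.
Context {R : realType}.
Notation mu := (@lebesgue_measure R).
Notation RR := (measurableTypeR R).

Lemma reflection_invariant (x : R) (A : set RR) : measurable A ->
  mu ((fun h : RR => (x - h)%R : RR) @^-1` A) = mu A.
Proof.
move=> mA; have mf : measurable_fun setT (fun h : RR => (x + h)%R : RR).
  exact: measurable_funD.
have -> : (fun h : RR => (x - h)%R : RR) @^-1` A =
  (-%R : RR -> RR) @^-1` ((fun h : RR => (x + h)%R : RR) @^-1` A) by [].
rewrite [LHS](lebesgue_measureN (measurable_preimageT mf mA)).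
exact: (leb_vadd 0 x A mA).
Qed.

Variables (s : R) (A B : set RR) (a b : R).
Hypotheses (s0 : 0 < s) (mA : measurable A) (mB : measurable B)
  (Aa : mu A = a%:E) (Bb : mu B = b%:E) (b0 : 0 < b).
Notation D := (~` (A `|` B)).
Notation m := (right_mass A).

Let mD : measurable D.
Proof. by apply: measurableC; exact: measurableU. Qed.

Lemma right_mass_bounds x : 0 <= m x <= a.
Proof.
rewrite -!lee_fin -(right_massE A a mA Aa) measure_ge0/= -Aa.
apply: le_measure; rewrite ?inE//; apply: measurableI => //; exact: measurable_itv.
Qed.

(** The half-line bound is applied on each side of [x]. Nothing is known about how [B] is split by
    [x], so all of [b] is charged to both sides. *)
Lemma integral_ker_ge (x : RR) :
  ((((m x + b) `^ (- (2 * s)) + (a - m x + b) `^ (- (2 * s))) / (2 * s))%:E <=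
  \int[mu]_(y in D) ker 0 s (x : Rn R 0) y)%E.
Proof.
have /andP[m0 ma] := right_mass_bounds x.
pose Hr : set RR := `]x : R, +oo[%classic; pose Hl : set RR := `]-oo, x : R[%classic.
have mHr : measurable Hr by exact: measurable_itv.
have mHl : measurable Hl by exact: measurable_itv.
have HD (H : set RR) (v : R) : measurable H -> (mu (A `&` H) <= v%:E)%E ->
    (mu (H `\` D) <= (v + b)%:E)%E.
  move=> mH Hv; apply: (@le_trans _ _ (mu (A `&` H) + mu B)%E).
    apply: le_trans (measureU2 _ _ _) => //; last exact: measurableI.
    apply: le_measure; rewrite ?inE.
    - exact: measurableD.
    - by apply: measurableU => //; exact: measurableI.
    by move=> y [Hy /contrapT[Ay|By]]; [left|right].
  by rewrite EFinD -Bb leeD2r.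
have Rr : (((m x + b) `^ (- (2 * s)) / (2 * s))%:E <=
    \int[mu]_(y in D `&` Hr) ker 0 s (x : Rn R 0) y)%E.
  apply: (integral_ker_halfline_ge s _ x (fun h => (x : R) + h)) => //.
  - by rewrite ltr_wpDl.
  - exact: measurable_funD.
  - by move=> E mE; exact: (leb_vadd 0 x E mE).
  - by apply/seteqP; split => h; rewrite /Hr /= !in_itv/= !andbT ltrDl.
  - by move=> h h0; rewrite opprD addNKr normrN gtr0_norm.
  - by apply: HD => //; rewrite (right_massE A a mA Aa).
have Rl : (((a - m x + b) `^ (- (2 * s)) / (2 * s))%:E <=
    \int[mu]_(y in D `&` Hl) ker 0 s (x : Rn R 0) y)%E.
  apply: (integral_ker_halfline_ge s _ x (fun h => (x : R) - h)) => //.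
  - by rewrite ltr_wpDl// subr_ge0.
  - exact: measurable_funB.
  - by move=> E mE; exact: reflection_invariant.
  - by apply/seteqP; split => h; rewrite /Hl /= !in_itv/= !andbT gtrBl.
  - by move=> h h0; rewrite opprB addrC subrK gtr0_norm.
  - apply: HD => //; rewrite -(left_massE A a mA Aa).
    apply: le_measure; rewrite ?inE.
    + exact: measurableI.
    + by apply: measurableI => //; exact: measurable_itv.
    by apply: setIS => y; rewrite /Hl /= !in_itv/=; exact: ltW.
rewrite mulrDl EFinD; apply: (le_trans (leeD Rr Rl)).
have mk E : measurable_fun E (ker 0 s (x : Rn R 0)).
  by apply: measurable_funTS; exact: measurable_kerl.
rewrite -ge0_integral_setU//.
- apply: ge0_subset_integral => //.
  + by apply: measurableU; exact: measurableI.
  + by move=> y _; exact: ker_ge0.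
  + by move=> y [[]|[]].
- exact: measurableI.
- exact: measurableI.
- by move=> y _; exact: ker_ge0.
- apply/disj_setPS => y [[_ +] [_ +]]; rewrite /Hr /Hl /= !in_itv/= andbT.
  by move=> xy /(lt_trans xy); rewrite ltxx.
Qed.

(** The points where the right mass is a multiple of [a / K] cut [A] into slices of mass [a / K]. On
    a slice the right mass varies between two consecutive multiples, which bounds the inner
    integral. The two extreme slices are dropped, since the levels 0 and [a] need not be attained:
    hence [K - 2] terms. *)
Lemma Lint_ge_slices (K : nat) : (0 < K)%N -> 0 < a ->
  ((\sum_(0 <= i < K - 2) ((((i.+2%:R * (a / K%:R) + b) `^ (- (2 * s)) +
      ((K - i.+1)%:R * (a / K%:R) + b) `^ (- (2 * s))) / (2 * s)) * (a / K%:R)))%:E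
   <= Lint s (A : set (Rn R 0)) D)%E.
Proof.
move=> K0 a0; set d := a / K%:R.
have s20 : 0 <= 2 * s by rewrite mulr_ge0// ltW.
have K0' : 0 < K%:R :> R by rewrite ltr0n.
have d0 : 0 < d by rewrite divr_gt0.
have dK : K%:R * d = a by rewrite /d mulrC divfK// lt0r_neq0.
(* Beyond the range of levels the chosen point is arbitrary, and [F] below is empty there. *)
have /choice[x xE] : forall i, exists x, (i.+1 < K)%N -> m x = i.+1%:R * d.
  move=> i; have [iK|_] := ltnP i.+1 K; last by exists 0.
  have [|x xE] := right_mass_onto A a mA Aa (i.+1%:R * d).
    by rewrite mulr_gt0//= -dK ltr_pM2r// ltr_nat.
  by exists x.
have xle i j : (i < j)%N -> (j.+1 < K)%N -> x j <= x i.
  move=> ij jK; rewrite leNgt; apply/negP => xx.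
  have /andP[+ _] := right_mass_lip A a mA Aa _ _ (ltW xx).
  rewrite !xE//; last by rewrite (ltn_trans _ jK).
  by rewrite -mulrBl pmulr_lge0// subr_ge0 ler_nat ltnS leqNgt ij.
pose F i : set RR := if (i.+2 < K)%N then A `&` `]x i.+1, x i] else set0.
have mF i : measurable (F i).
  by rewrite /F; case: ifP => // _; apply: measurableI => //; exact: measurable_itv.
have tF : trivIset setT F.
  apply: ltn_trivIset => j i ij; rewrite /F.
  case: ifPn => [iK|_]; last by rewrite ?set0I ?setI0.
  case: ifPn => [jK|_]; last by rewrite ?set0I ?setI0.
  apply/seteqP; split => y // [[_ /=]]; rewrite in_itv/= => /andP[xy1 xy2].
  move=> [_ /=]; rewrite in_itv/= => /andP[xy3 xy4].
  have : x j <= x i.+1.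
    by move: ij; rewrite leq_eqVlt => /orP[/eqP <-//|ij]; apply: xle => //; rewrite ltnW.
  by move=> /(le_trans xy4)/(lt_le_trans xy1); rewrite ltxx.
pose v i := (((i.+2%:R * d + b) `^ (- (2 * s)) +
      ((K - i.+1)%:R * d + b) `^ (- (2 * s))) / (2 * s)).
have := @ge0_integral_ge_sum _ _ _ mu A
  (fun x => \int[mu]_(y in D) ker 0 s (x : Rn R 0) y)%E
  (K - 2) F v mA (measurable_integral_ker 0 s D mD) _ mF tF.
have -> : (\sum_(0 <= i < K - 2) (v i)%:E * mu (F i) =
    (\sum_(0 <= i < K - 2) v i * d)%:E)%E.
  rewrite -sumEFin; apply: eq_big_nat => i /andP[_]; rewrite ltn_subRL add2n => iK.
  rewrite [RHS]EFinM; congr (_ * _)%E; rewrite /F iK.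
  rewrite (mid_massE A a mA Aa); last exact: xle.
  rewrite !xE ?(ltnW iK)//; congr EFin.
  by rewrite -[i.+2]addn1 natrD; ring.
apply.
- by move=> y; apply: integral_ge0 => z _; exact: ker_ge0.
- by move=> i; rewrite ltn_subRL add2n /F => ->; exact: subIsetl.
- by move=> i; apply: divr_ge0; [rewrite addr_ge0 ?powR_ge0|].
move=> i; rewrite ltn_subRL add2n /F => iK y; rewrite iK => -[Ay /=].
rewrite in_itv/= => /andP[xy yx].
have /andP[m1 _] := right_mass_lip A a mA Aa _ _ (ltW xy).
have /andP[m2 _] := right_mass_lip A a mA Aa _ _ yx.
rewrite subr_ge0 xE// in m1; rewrite subr_ge0 xE ?(ltnW iK)// in m2.
have /andP[my0 mya] := right_mass_bounds y.
apply: le_trans (integral_ker_ge y); rewrite lee_fin ler_wpM2r//.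
  by rewrite invr_ge0.
apply: lerD; apply: powRN_le => //.
- by rewrite ltr_wpDl.
- by rewrite lerD2r.
- by rewrite ltr_wpDl// subr_ge0.
rewrite lerD2r natrB; last by rewrite ltnW// ltnW.
by rewrite mulrBl dK lerD2l lerN2.
Qed.

(** By [powRN_sub_le] each term dominates a difference of consecutive powers, and these differences
    telescope. *)
Lemma sum_powRN_ge (t d : R) (K : nat) : 0 < t -> 0 < d ->
  ((2%:R * d + b) `^ (- t) - ((K.+2)%:R * d + b) `^ (- t)) / t <=
  \sum_(0 <= i < K) (i.+2%:R * d + b) `^ (- (1 + t)) * d.
Proof.
move=> t0 d0; elim: K => [|K IH]; first by rewrite big_nil subrr mul0r.
rewrite big_nat_recr//=.
have u0 : 0 < K.+2%:R * d + b by rewrite ltr_wpDl// mulr_ge0// ltW.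
have := powRN_sub_le t _ d t0 u0 (ltW d0).
have -> : K.+2%:R * d + b + d = K.+3%:R * d + b.
  by rewrite -[K.+3]addn1 natrD; ring.
move: IH; rewrite !ler_pdivrMr//; nra.
Qed.

Lemma Lint_ge_sharp (K : nat) : (1 < K)%N -> 0 < a -> 2^-1 < s ->
  ((((2 * (a / K%:R) + b) `^ (- (2 * s - 1)) - (a + b) `^ (- (2 * s - 1)))
     / ((2 * s - 1) * s))%:E
   <= Lint s (A : set (Rn R 0)) D)%E.
Proof.
move=> K1 a0 s2; have K0 : (0 < K)%N by exact: ltnW.
apply: le_trans (Lint_ge_slices K K0 a0); rewrite lee_fin.
set d := a / K%:R; pose t := 2 * s - 1.
have t0 : 0 < t by rewrite /t; lra.
have K0' : 0 < K%:R :> R by rewrite ltr0n.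
have d0 : 0 < d by rewrite divr_gt0.
have dK : K%:R * d = a by rewrite /d mulrC divfK// lt0r_neq0.
have H := sum_powRN_ge t d (K - 2) t0 d0.
have K2 : (K - 2).+2 = K by rewrite -addn2 subnK.
rewrite K2 dK in H.
pose g (i : nat) := (i.+2%:R * d + b) `^ (- (1 + t)) * d.
rewrite (_ : \sum_(0 <= i < K - 2) _ = (\sum_(0 <= i < K - 2) g i) / s).
  by rewrite -/t invfM mulrA ler_wpM2r// invr_ge0 ltW.
(* The left contributions are the right ones in reverse order, so both sums are equal and the 2 in
   [2 s] cancels. *)
transitivity (\sum_(0 <= i < K - 2) (g i + g (K - 2 - i.+1)%N) / (2 * s)).
  apply: eq_big_nat => i /andP[_]; rewrite ltn_subRL add2n => iK.
  rewrite /g; have -> : (K - 2 - i.+1).+2 = (K - i.+1)%N.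
    by rewrite subnAC -addn2 subnK// ltn_subRL addn1.
  have -> : 1 + t = 2 * s by rewrite /t; ring.
  by ring.
rewrite -mulr_suml big_split/=.
rewrite [X in _ + X](_ : _ = \sum_(0 <= i < K - 2) g i); last first.
  by rewrite [RHS]big_nat_rev.
by field; exact: lt0r_neq0.
Qed.

End one_dimensional_sharp.

(** * Absorbing the error terms in dimension one *)

Section one_dimensional_conclusion.
Context {R : realType}.

Lemma Lint_ge_powR_measure (s : R) : 2^-1 < s < 1 ->
  exists2 c1 : R, 0 < c1 & forall (A B : set (Rn R 0)) (a b : R),
    measurable A -> measurable B -> leb R 0 A = a%:E -> leb R 0 B = b%:E ->
    0 < a -> 0 < b -> b <= c1 * a ->
    ((b `^ (1 - 2 * s))%:E <= Lint s A (~` (A `|` B)))%E.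
Proof.
move=> /andP[s2 s1].
pose t := 2 * s - 1; have t0 : 0 < t by rewrite /t; lra.
have t1 : t < 1 by rewrite /t; lra.
have s0 : 0 < s by lra.
pose th := t * s; have th0 : 0 < th by rewrite mulr_gt0.
have th1 : th < 1 by rewrite /th; nra.
(* With this choice [1 / (1 + eps) = (1 + th) / 2]. The gap between [th] and 1 is split in two: one
   half pays for the slices, the other for the subtracted power of [a + b]. *)
pose eps := (1 - th) / (1 + th).
have eps0 : 0 < eps by rewrite divr_gt0; lra.
(* For [b / a] below this value, [a ^ (- t) <= b ^ (- t) (1 - th) / 2]. *)
exists (((1 - th) / 2) `^ t^-1); first by rewrite powR_gt0//; lra.
move=> A B a b mA mB Aa Bb a0 b0 bca.
(* Enough slices for [2 a / K <= eps b]. *)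
pose K := (Num.truncn (2 * a / (eps * b))).+2.
have K0 : 0 < K%:R :> R by rewrite ltr0n.
have Kab : 2 * (a / K%:R) <= eps * b.
  rewrite mulrA ler_pdivrMr// ltW//.
  have /lt_trans : 2 * a / (eps * b) < K.-1%:R by exact: truncnS_gt.
  move=> /(_ K%:R); rewrite ltr_nat ltnSn => /(_ erefl).
  by rewrite (ltr_pdivrMr _ _ (mulr_gt0 eps0 b0)) [_ * (eps * b)]mulrC.
apply: le_trans (Lint_ge_sharp s A B a b s0 mA mB Aa Bb b0 K _ a0 s2) => //.
rewrite lee_fin -/t -/th (_ : 1 - 2 * s = - t); last by rewrite /t; ring.
rewrite ler_pdivlMr//.
have H1 : b `^ (- t) * ((1 + th) / 2) <= (2 * (a / K%:R) + b) `^ (- t).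
  apply: (@le_trans _ _ ((b * (1 + eps)) `^ (- t))); last first.
    apply: powRN_le; [exact: ltW| |].
    - by rewrite ltr_wpDl// mulr_ge0// divr_ge0// ltW.
    - by lra.
  rewrite powRM; [|exact: ltW|lra]; rewrite ler_wpM2l ?powR_ge0//.
  have -> : (1 + th) / 2 = (1 + eps)^-1 by rewrite /eps; field; lra.
  rewrite -powR_inv1; last by lra.
  by apply: ler_powR; lra.
have H2 : (a + b) `^ (- t) <= b `^ (- t) * ((1 - th) / 2).
  apply: (@le_trans _ _ (a `^ (- t))).
    by apply: powRN_le => //; [exact: ltW|lra].
  rewrite !powRN mulrC ler_pdivlMr ?powR_gt0// mulrC ler_pdivrMr ?powR_gt0//.
  have -> : (1 - th) / 2 = (((1 - th) / 2) `^ t^-1) `^ t.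
    by rewrite -powRrM mulVf ?lt0r_neq0// powRr1//; lra.
  rewrite -powRM ?powR_ge0//; last exact: ltW.
  by apply: ge0_ler_powR => //; rewrite ?nnegrE ?mulr_ge0 ?powR_ge0// ltW.
lra.
Qed.

End one_dimensional_conclusion.

(** * Choice of the constant *)

Section conclusion.
Context {R : realType}.

Lemma exp2_bracket (x : R) : 1 <= x -> exists J : nat, 2 ^+ J <= x < 2 ^+ J.+1.
Proof.
move=> x1; have [J xJ _] : exists2 J : nat, x < 2 ^+ J & true.
  exists (Num.truncn x).+1 => //; apply: (lt_trans (truncnS_gt x)).
  by rewrite -natrX ltr_nat ltn_expl.
elim: J xJ => [|J IH] xJ; first by move: xJ; rewrite expr0 ltNge x1.
by have [/IH//|Jx] := ltP x (2 ^+ J); exists J; rewrite Jx.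
Qed.

Lemma eq_pinfty_of_ge_muln (v : R) (x : \bar R) : 0 < v ->
  (forall k : nat, ((v * k.+1%:R)%:E <= x)%E) -> x = +oo%E.
Proof.
move=> v0 H; apply/eqyP => e e0.
apply: le_trans (H (Num.truncn (e / v))); rewrite lee_fin mulrC -ler_pdivrMr//.
by rewrite ltW// truncnS_gt.
Qed.

Lemma sum_powR_ge_card (t : R) (J : nat) : 0 <= t ->
  J.+1%:R <= \sum_(0 <= j < J.+1) (2 `^ t) ^+ j.
Proof.
move=> t0; rewrite (_ : J.+1%:R = \sum_(0 <= j < J.+1) (1 : R)).
  by apply: ler_sum => j _; rewrite exprn_ege1// -[leLHS](powRr0 2) ler_powR// ler1n.
by rewrite sumr_const_nat subn0.
Qed.

Lemma sum_powR_ge_last (t : R) (J : nat) :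
  (2 ^+ J) `^ t <= \sum_(0 <= j < J.+1) (2 `^ t) ^+ j.
Proof.
rewrite big_nat_recr//= -!powR_mulrn ?powR_ge0// powRAC lerDr.
by apply: sumr_ge0 => j _; rewrite exprn_ge0// powR_ge0.
Qed.

Lemma Lint_ge0 n (s : R) (A D : set (Rn R n)) : (0 <= Lint s A D)%E.
Proof.
by apply: integral_ge0 => x _; apply: integral_ge0 => y _; exact: (ker_ge0 n s x y).
Qed.

(** For [s > 1/2] this is the sharp bound. At [s = 1/2] the right side is 1, and every dyadic scale
    contributes the same constant [C0], so enough scales suffice. *)
Lemma dim1_ge_powR_measure (s : R) : 2^-1 <= s < 1 ->
  exists2 c1 : R, 0 < c1 & forall (A B : set (Rn R 0)) (a b : R),
    measurable A -> measurable B -> A `&` B = set0 ->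
    leb R 0 A = a%:E -> leb R 0 B = b%:E ->
    0 < a -> 0 < b -> b <= c1 * a ->
    ((b `^ (1 - 2 * s))%:E <= Lint s A (~` (A `|` B)))%E.
Proof.
move=> /andP[]; rewrite le_eqVlt => /orP[/eqP <- _|s2 s1]; last first.
  have [|c1 c10 H] := @Lint_ge_powR_measure R s; first by rewrite s2.
  by exists c1 => // A B a b mA mB _; exact: H.
have h0 : 0 < 2^-1 :> R by lra.
have Hd := @Lint_ge_dyadic R 0 2^-1 h0.
set C0 := shell_constant 0 2^-1 in Hd.
have C00 : 0 < C0 by exact: shell_constant_gt0.
have [J HJ] : exists J : nat, C0^-1 <= J.+1%:R.
  by exists (Num.truncn C0^-1); rewrite ltW// truncnS_gt.
(* Below this ratio the scales up to [J] are admissible, and [C0 * (J + 1) >= 1]. *)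
exists (4 * 2 ^+ J)^-1; first by rewrite invr_gt0 mulr_gt0// exprn_gt0.
move=> A B a b mA mB AB Aa Bb a0 b0 bca.
apply: le_trans (Hd A B a b J mA mB AB Aa Bb a0 (ltW b0) _); last first.
  move: bca; rewrite mulrC ler_pdivlMr; last by rewrite mulr_gt0// exprn_gt0.
  suff -> : b * (4 * 2 ^+ J) = 2 ^+ J * (4 * b) by [].
  by move: (2 ^+ J) => x; ring.
rewrite lee_fin divff// !subrr mul0r !powRr0 mul1r.
under eq_bigr do rewrite expr1n.
by rewrite sumr_const_nat subn0 mulrC -ler_pdivrMr// div1r.
Qed.

Lemma ratio_le (u v : R) : 0 < u -> u <= v -> u / (1 + u) <= v / (1 + v).
Proof.
move=> u0 uv; rewrite ler_pdivrMr; last by lra.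
by rewrite mulrAC ler_pdivlMr; lra.
Qed.

(** The threshold [c] is left free below [c'], because the final constant must satisfy other
    conditions too. *)
Lemma Lint_ge_large (n : nat) (s : R) : 0 < s < 1 ->
  exists2 c' : R, 0 < c' & forall (c a b : R) (A B : set (Rn R n)),
    0 < c -> c <= c' -> c < 1 ->
    measurable A -> measurable B -> A `&` B = set0 ->
    leb R n A = a%:E -> leb R n B = b%:E -> 0 < a -> c * a < b ->
    ((c * a `^ ((n.+1%:R - 2 * s) / n.+1%:R) *
      (b / a) `^ (- (2 * s) / n.+1%:R))%:E <= Lint s A (~` (A `|` B)))%E.
Proof.
move=> /andP[s0 s1]; set N := n.+1%:R; pose q := 2 * s / N.
have N0 : 0 < N by rewrite ltr0n.
have q0 : 0 < q by rewrite divr_gt0//; lra.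
have eq1 : (N - 2 * s) / N = 1 - q by rewrite /q; field; exact: lt0r_neq0.
have Ht := @Lint_ge_total R n s s0.
set C1 := cube_constant n s in Ht.
have C10 : 0 < C1 by exact: cube_constant_gt0.
(* The cube estimate in terms of [b / a]: it reaches the target as soon as [c] is below a constant
   times [(b / (a + b)) ^ q]. *)
have Hr (c a b : R) (A B : set (Rn R n)) : 0 < b ->
    measurable A -> measurable B ->
    leb R n A = a%:E -> leb R n B = b%:E -> 0 < a ->
    c <= C1 * (b / a / (1 + b / a)) `^ q ->
    ((c * a `^ (1 - q) * (b / a) `^ (- q))%:E <= Lint s A (~` (A `|` B)))%E.
  move=> b0 mA mB Aa Bb a0 cC; apply: le_trans (Ht A B a b mA mB Aa Bb a0 (ltW b0)).
  have ba0 : 0 < b / a by rewrite divr_gt0.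
  have -> : a * (a + b) `^ (- (2 * s) / n.+1%:R) =
      a `^ (1 - q) * (b / a) `^ (- q) * (b / a / (1 + b / a)) `^ q.
    have -> : a + b = a * (1 + b / a) by field; exact: lt0r_neq0.
    have -> : - (2 * s) / n.+1%:R = - q by rewrite /q mulNr.
    move: (b / a) ba0 => x x0; have x1 : 0 <= 1 + x by lra.
    have xV : 0 <= (1 + x)^-1 by rewrite invr_ge0.
    rewrite (powRM _ (ltW a0) x1) (powRM _ (ltW x0) xV).
    rewrite powRDg// powRr1; last exact: ltW.
    rewrite -[(1 + x)^-1]powR_inv1// -powRrM mulN1r (powRN x).
    by field; rewrite gt_eqF// powR_gt0.
  rewrite lee_fin.
  have h0 : 0 <= a `^ (1 - q) * (b / a) `^ (- q) by rewrite mulr_ge0// powR_ge0.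
  have := ler_wpM2l h0 cC; lra.
rewrite eq1 (_ : - (2 * s) / N = - q); last by rewrite /q mulNr.
have [q1|q1] := ltP q 1.
  (* At the threshold the cube estimate is of order [c ^ q], which dominates [c] for small [c] since
     [q < 1]; this value gives [c ^ (1 - q) <= C1 / 2]. *)
  exists ((C1 / 2) `^ (1 - q)^-1); first by rewrite powR_gt0// divr_gt0.
  move=> c a b A B c0 cc' c1 mA mB AB Aa Bb a0 cab.
  have b0 : 0 < b by rewrite (le_lt_trans _ cab)// mulr_ge0// ltW.
  apply: Hr => //.
  have cba : c <= b / a by rewrite ler_pdivlMr// ltW.
  have hc : c / 2 <= b / a / (1 + b / a).
    apply: le_trans (ratio_le _ _ c0 cba).
    by rewrite ler_wpM2l ?(ltW c0)// lef_pV2 ?posrE//; lra.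
  have hq : (c / 2) `^ q <= (b / a / (1 + b / a)) `^ q.
    apply: ge0_ler_powR; rewrite ?nnegrE//; [exact: ltW|lra|].
    by rewrite (le_trans _ hc)//; lra.
  have hC : c `^ (1 - q) <= C1 / 2.
    have -> : C1 / 2 = ((C1 / 2) `^ (1 - q)^-1) `^ (1 - q).
      rewrite -powRrM mulVf ?powRr1//; first by rewrite divr_ge0// ltW.
      by rewrite gt_eqF//; lra.
    by apply: ge0_ler_powR; rewrite ?nnegrE ?powR_ge0//; [lra|exact: ltW].
  have h2 : 2^-1 <= 2^-1 `^ q :> R.
    by apply: ger1_powR; lra.
  have cE : c = c `^ (1 - q) * c `^ q.
    by rewrite -powRDg// subrK powRr1// ltW.
  have hq' : c `^ q * 2^-1 <= (b / a / (1 + b / a)) `^ q.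
    apply: le_trans hq; rewrite powRM; [|exact: ltW|lra].
    by rewrite ler_wpM2l ?powR_ge0.
  rewrite {1}cE.
  have := ler_wpM2r (powR_ge0 c q) hC; have := ler_wpM2l (ltW C10) hq'; lra.
(* Now [q >= 1], and [s < 1] forces dimension one with [s >= 1/2]. *)
have N2s : N <= 2 * s by move: q1; rewrite /q ler_pdivlMr// mul1r.
have n0 : n = 0%N.
  have : N < 2%:R by lra.
  by rewrite ltr_nat; case: (n) => [|[]].
have hs : 2^-1 <= s < 1.
  by rewrite s1 andbT; move: N2s; rewrite /N n0; lra.
have qE : q = 2 * s by rewrite /q /N n0 divr1.
move: {Ht} @C1 C10 Hr; rewrite n0 => C1 C10 Hr.
have [c1 c10 H1] := @dim1_ge_powR_measure s hs.
exists (C1 * (c1 / (1 + c1)) `^ q).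
  by rewrite mulr_gt0// powR_gt0// divr_gt0//; lra.
move=> c a b A B c0 cc' c11 mA mB AB Aa Bb a0 cab.
have b0 : 0 < b by rewrite (le_lt_trans _ cab)// mulr_ge0// ltW.
(* Above [c1 a] the cube estimate suffices by the choice of [c']. Below it, the target is
   [c a b ^ (- 2 s)], which [c a < b] bounds by [b ^ (1 - 2 s)]. *)
have [bc|cb] := leP b (c1 * a); last first.
  apply: Hr => //; apply: (le_trans cc'); rewrite ler_wpM2l ?(ltW C10)//.
  apply: ge0_ler_powR; rewrite ?nnegrE; first exact: ltW.
  - by rewrite divr_ge0//; lra.
  - by rewrite divr_ge0// ?addr_ge0// ?divr_ge0// ltW.
  by apply: ratio_le => //; rewrite ler_pdivlMr// ltW.
apply: le_trans (H1 A B a b mA mB AB Aa Bb a0 b0 bc).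
rewrite lee_fin qE powRM; [|exact: ltW|by rewrite invr_ge0 ltW].
have -> : a^-1 `^ (- (2 * s)) = a `^ (2 * s).
  by rewrite -[a^-1]powR_inv1 ?(ltW a0)// -powRrM mulN1r opprK.
have -> : c * a `^ (1 - 2 * s) * (b `^ (- (2 * s)) * a `^ (2 * s)) =
    c * a * b `^ (- (2 * s)).
  have -> : c * a = c * (a `^ (1 - 2 * s) * a `^ (2 * s)).
    by rewrite -powRDg// subrK powRr1// ltW.
  ring.
rewrite powRDg// powRr1; last exact: ltW.
by rewrite ler_wpM2r ?powR_ge0// ltW.
Qed.

End conclusion.

(* Dimension N = n.+1 >= 1; |A| = leb R n A; a = |A|, b = |B| as reals;
   L(A,D) = Lint s A D. *)
Theorem theorem1p6 (R : realType) (n : nat) (s : R) :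
  0 < s < 1 ->
  exists c : R, 0 < c < 1 /\
    forall A B : set (Rn R n),
      measurable A -> measurable B -> A `&` B = set0 ->
      (leb R n A < +oo)%E -> (leb R n B < +oo)%E ->
      let D := ~` (A `|` B) in
      let N : R := (n.+1)%:R in
      let a : R := fine (leb R n A) in
      let b : R := fine (leb R n B) in
      (b <= c * a -> 0 < a ->
        (s < 2^-1 ->
           ((c * a `^ ((N - 2 * s) / N))%:E <= Lint s A D)%E) /\
        (s = 2^-1 ->
           ((if (b == 0)%R then +oo
             else (c * a `^ ((N - 1) / N) * ln (a / b))%R%:E) <= Lint s A D)%E) /\
        (2^-1 < s ->
           ((if (b == 0)%R then +oo
             else (c * a `^ ((N - 2 * s) / N) * (b / a) `^ (1 - 2 * s))%R%:E)
              <= Lint s A D)%E)) /\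
      (c * a < b ->
        ((c * a `^ ((N - 2 * s) / N) * (b / a) `^ (- (2 * s) / N))%:E
          <= Lint s A D)%E).
Proof.
move=> s01; have /andP[s0 s1] := s01.
have [c' c'0 H2] := @Lint_ge_large R n s s01.
have Hd := @Lint_ge_dyadic R n s s0.
set C0 := shell_constant n s in Hd.
have C00 : 0 < C0 by exact: shell_constant_gt0.
(* [1/16] makes two dyadic scales available and keeps [a / (4 b) >= 4]; [C0 / 8] absorbs the losses
   of the dyadic sums; [c'] serves the regime of large [B]. *)
pose c := Num.min (16^-1) (Num.min (C0 / 8) c').
have c0 : 0 < c by rewrite !lt_min c'0 divr_gt0// invr_gt0 ltr0n.
have [c16 cC cc'] : [/\ c <= 16^-1, c <= C0 / 8 & c <= c'].
  by rewrite /c !ge_min !lexx !orbT.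
have c1 : c < 1 by lra.
exists c; split; first by rewrite c0.
move=> A B mA mB AB Afin Bfin D N a b.
have Aa : leb R n A = a%:E by rewrite fineK// ge0_fin_numE.
have Bb : leb R n B = b%:E by rewrite fineK// ge0_fin_numE.
have b0 : 0 <= b by exact: fine_ge0.
have a0' : 0 <= a by exact: fine_ge0.
split; last first.
  (* If [a = 0], the quotient [b / a] is 0 by convention, and so is its nonzero power: the bound
     reads [0 <= L(A,D)]. *)
  move=> cab; have [a0|a0] := eqVneq a 0; last first.
    by apply: H2 => //; rewrite lt_def a0.
  rewrite a0 invr0 mulr0 (powR0 (x := - (2 * s) / N)) ?mulr0 ?Lint_ge0//.
  rewrite mulf_neq0// ?invr_neq0 ?pnatr_eq0// oppr_eq0 mulf_neq0//.
  exact: lt0r_neq0.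
move=> bca a0; have b16 : 16 * b <= a by nra.
have av0 : 0 < a `^ ((N - 2 * s) / N) by rewrite powR_gt0.
(* If [b = 0] every dyadic scale is admissible, and for [2 s >= 1] the sum over scales is
   unbounded. *)
have bnd0 : b = 0 -> 2^-1 <= s -> Lint s A D = +oo%E.
  move=> b00 s2; apply: (@eq_pinfty_of_ge_muln _ (C0 * a `^ ((N - 2 * s) / N))).
    by rewrite mulr_gt0.
  move=> k; apply: le_trans (Hd A B a b k mA mB AB Aa Bb a0 b0 _); last first.
    by rewrite b00 !mulr0.
  rewrite lee_fin -mulrA !ler_wpM2l ?(ltW C00) ?(ltW av0)//.
  by apply: sum_powR_ge_card; lra.
(* [J] is the last admissible scale. *)
have bracket : 0 < b -> exists J : nat,
    2 ^+ J * (4 * b) <= a /\ a < 2 ^+ J.+1 * (4 * b).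
  move=> bp; have b4 : 0 < 4 * b by lra.
  have [|J /andP[J1 J2]] := @exp2_bracket R (a / (4 * b)).
    by rewrite ler_pdivlMr//; lra.
  by exists J; rewrite -ler_pdivlMr// -ltr_pdivrMr.
split; [|split].
- move=> s2; apply: le_trans (Hd A B a b 0 mA mB AB Aa Bb a0 b0 _); last first.
    by rewrite expr0 mul1r; lra.
  rewrite big_nat1 expr0 mulr1 lee_fin ler_wpM2r ?(ltW av0)//; lra.
- move=> s2; case: eqP => [b00|/eqP bn0]; first by rewrite bnd0 ?leey// s2.
  have bp : 0 < b by rewrite lt_def bn0.
  have [J [J1 J2]] := bracket bp.
  apply: le_trans (Hd A B a b J mA mB AB Aa Bb a0 b0 J1).
  rewrite lee_fin (_ : N - 1 = N - 2 * s); last by rewrite s2; field.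
  rewrite mulrAC mulrA [leLHS]mulrC [C0 * _]mulrC -[leRHS]mulrA ler_wpM2l ?(ltW av0)//.
  have hJ : J.+1%:R <= \sum_(0 <= j < J.+1) (2 `^ (2 * s - 1)) ^+ j.
    by apply: sum_powR_ge_card; lra.
  have rho4 : 4 <= a / (4 * b) by rewrite ler_pdivlMr; lra.
  have ln2 : ln 2 <= 1 :> R by rewrite -[2]/(1 + 1) le_ln1Dx; lra.
  have hln : ln (a / (4 * b)) <= J.+1%:R.
    apply: (@le_trans _ _ (ln (2 ^+ J.+1))).
      rewrite ler_ln ?posrE ?exprn_gt0//; last by rewrite divr_gt0//; lra.
      by rewrite ler_pdivrMr ?ltW//; lra.
    by rewrite lnXn// ler_wMn2r.
  have lnab : ln (a / b) = ln 4 + ln (a / (4 * b)).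
    rewrite -lnM ?posrE//; last by rewrite divr_gt0//; lra.
    by congr ln; field; exact: lt0r_neq0.
  (* Hence [ln (a / b)] is at most twice [ln (a / (4 b))], and so at most [2 (J + 1)]. *)
  have ln4 : ln 4 <= ln (a / (4 * b)) by rewrite ler_ln ?posrE//; lra.
  have ln40 : 0 <= ln 4 :> R by apply: ln_ge0; rewrite ler1n.
  rewrite lnab.
  have : 0 <= c * (J.+1%:R) by rewrite mulr_ge0 ?(ltW c0).
  have := ler_wpM2l (ltW C00) hJ.
  have := ler_wpM2r (ler0n R J.+1) cC.
  have := ler_wpM2l (ltW c0) hln.
  have := ler_wpM2l (ltW c0) ln4.
  have : 0 <= C0 * J.+1%:R by rewrite mulr_ge0 ?(ltW C00).
  lra.
- move=> s2; case: eqP => [b00|/eqP bn0]; first by rewrite bnd0 ?leey// ltW.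
  have bp : 0 < b by rewrite lt_def bn0.
  have [J [J1 J2]] := bracket bp.
  apply: le_trans (Hd A B a b J mA mB AB Aa Bb a0 b0 J1).
  rewrite lee_fin mulrAC mulrA [leLHS]mulrC [C0 * _]mulrC -[leRHS]mulrA.
  rewrite ler_wpM2l ?(ltW av0)//.
  have hJ := sum_powR_ge_last (2 * s - 1) J.
  pose t := 2 * s - 1; have t0 : 0 < t by rewrite /t; lra.
  have t1 : t < 1 by rewrite /t; lra.
  (* Maximality of [J] gives [a / b < 8 * 2 ^ J], and [8 ^ (- t) >= 1/8] because [t < 1]. *)
  have h8 : (b / a) `^ (- t) * 8^-1 <= (2 ^+ J) `^ t.
    apply: (@le_trans _ _ ((a / b * 8^-1) `^ t)).
      have ab0 : 0 <= a / b by rewrite divr_ge0.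
      have e8 : 0 <= 8^-1 :> R by lra.
      rewrite (powRM _ ab0 e8).
      have -> : (b / a) `^ (- t) = (a / b) `^ t.
        rewrite -[a / b]invrK invf_div -[(b / a)^-1]powR_inv1.
          by rewrite -powRrM mulN1r.
        by rewrite divr_ge0.
      by rewrite ler_wpM2l ?powR_ge0// ger1_powR//; lra.
    apply: ge0_ler_powR; rewrite ?nnegrE; first exact: ltW.
    - by rewrite mulr_ge0// ?divr_ge0//; lra.
    - by rewrite exprn_ge0.
    - rewrite mulrAC ler_pdivrMr// ; move: J2; rewrite exprS; lra.
  have -> : 1 - 2 * s = - t by rewrite /t; ring.
  have := ler_wpM2l (ltW C00) (le_trans h8 hJ).
  have := ler_wpM2r (powR_ge0 (b / a) (- t)) cC.
  rewrite -/t; lra.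
Qed.
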